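(* Let $d\ge 2$, let $\Gamma\subset\mathbb Z^d$ be a lattice of full rank which is not divisible, let $V\colon\mathbb Z^d\to\mathbb R$ be a $\Gamma$-periodic potential, and let $H=\Delta+V$ be the corresponding discrete Schr\''odinger operator with spectral band functions $E_1\le\dots\le E_N$ and band edges $E_j^-=\min_\theta E_j(\theta)$, $E_j^+=\max_\theta E_j(\theta)$. Then, for every $j\in\{1,\dots,N\}$, each of the two sets $$\{\theta\in\Omega'\colon E_j(\theta)=E_j^{-}\},\qquad \{\theta\in\Omega'\colon E_j(\theta)=E_j^{+}\}$$ has dimension at most $d-2$.
   Context: A lattice of full rank $\Gamma\subset\mathbb Z^d$ is $\Gamma=\{n_1a_1+\dots+n_da_d\colon n_j\in\mathbb Z\}$ with $a_1,\dots,a_d\in\mathbb Z^d$ linearly independent over $\mathbb R$. Its dual lattice is $\Gamma'=\{b\in\mathbb R^d\colon e^{2\pi i\langle b,a\rangle}=1\ \forall a\in\Gamma\}\supset\mathbb Z^d$; if $b_1,\dots,b_d$ is the dual basis ($\langle a_i,b_j\rangle=\delta_{ij}$), it is a basis of $\Gamma'$, and $\Omega'=\{\eta_1b_1+\dots+\eta_db_d\colon \eta_j\in[0,1)\}$ is an elementary cell of $\mathbb R^d/\Gamma'$. $\Gamma$ is called divisible if for any $(\varepsilon_1,\dots,\varepsilon_d)\in\{-1,1\}^d$ and any $j\in\{1,\dots,d\}$ there exists an integer $p_j\ge2$ such that $\frac1{p_j}(\varepsilon_1,\dots,\varepsilon_{j-1},\varepsilon_j,\varepsilon_{j+1},\dots,\varepsilon_d)\in\Gamma'$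 or $\frac1{p_j}(\varepsilon_1,\dots,\varepsilon_{j-1},-\varepsilon_j,\varepsilon_{j+1},\dots,\varepsilon_d)\in\Gamma'$. $V$ is $\Gamma$-periodic if $V(n+a)=V(n)$ for all $n\in\mathbb Z^d$, $a\in\Gamma$. The operator $H$ is defined by $(H\psi)(n)=\sum_{m\in\mathbb Z^d\colon|m-n|_1=1}\psi(m)+V(n)\psi(n)$, where $|n|_1=|n_1|+\dots+|n_d|$. For $\theta\in\mathbb R^d$ let $\ell^2_\theta(\mathbb Z^d/\Gamma)$ be the space of functions $\psi\colon\mathbb Z^d\to\mathbb C$ with $\psi(n+a)=e^{2\pi i\langle\theta,a\rangle}\psi(n)$ for all $n\in\mathbb Z^d$, $a\in\Gamma$; it has dimension $N=\#(\mathbb Z^d/\Gamma)$ and is identified, by restriction of functions, with $\ell^2(\Lambda)$ for the representative set $\Lambda=\{x_1a_1+\dots+x_da_d\colon x_j\in[0,1)\}\cap\mathbb Z^d$ of $\mathbb Z^d/\Gamma$. The formula for $H$ defines a self-adjoint operator $h(\theta)$ on this finite-dimensional space; $E_1(\theta)\le\dots\le E_N(\theta)$ are its eigenvalues counted with multiplicity. The functions $E_j$ (spectral band functions) are continuous and $\Gamma'$-periodic in $\theta$, and $[E_j^-,E_j^+]=\{E_j(\theta)\colon\theta\in\Omega'\}$. Dimension: the level sets in question are algebraic in suitable coordinates, hence can be represented as finite unions of smooth submanifolds, and any reasonable notion of dimension (e.g. Hausdorff dimension) may be used. *)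

(* Defs.v *)
From HB Require Import structures.
From mathcomp Require Import all_boot all_order all_algebra finmap.
From mathcomp Require Import all_classical all_reals all_analysis.
From mathcomp Require Import complex zify lra.

Set Implicit Arguments.
Unset Strict Implicit.
Unset Printing Implicit Defensive.

Import Order.TTheory GRing.Theory Num.Theory.

Local Open Scope classical_set_scope.
Local Open Scope ring_scope.

Section Euclidean.
Context {R : realType} {d : nat}.
Implicit Types (x y : 'rV[R]_d) (n : 'rV[int]_d).

Definition dotv x y : R := \sum_i x 0 i * y 0 i.

Definition enorm x : R := Num.sqrt (dotv x x).

Definition intv n : 'rV[R]_d := map_mx intr n.

(* exp(2 pi i t) *)
Definition cis2pi (t : R) : R[i] :=
  Complex (cos (2 * pi * t)) (sin (2 * pi * t)).

End Euclidean.

Section HausdorffDimension.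
Context {R : realType} {d : nat}.
Implicit Types (A U : set 'rV[R]_d) (s delta : R).
Local Open Scope ereal_scope.

(* The element 0 is added so that the empty set has diameter 0, not -oo. *)
Definition diam U : \bar R :=
  ereal_sup (0 |` [set (enorm (p.1 - p.2)%R)%:E | p in U `*` U]).

Definition hausdorff_content s delta A : \bar R :=
  ereal_inf [set \sum_(0 <= k <oo) poweR (diam (U k)) s |
             U in [set U : nat -> set 'rV[R]_d |
                   A `<=` \bigcup_k U k /\ forall k, diam (U k) <= delta%:E]].

Definition hausdorff_measure s A : \bar R :=
  ereal_sup [set hausdorff_content s delta A |
             delta in [set delta : R | (0 < delta)%R]].

(* Only exponents s > 0 are used: [poweR 0 0 = 1] would make empty members of
   a cover count when s = 0, and the infimum is the same. *)
Definition hausdorff_dim A : \bar R :=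
  ereal_inf [set s%:E | s in [set s : R |
             (0 < s)%R /\ hausdorff_measure s A = 0]].

End HausdorffDimension.

Section Lattice.
Variables (R : realType) (d : nat).
Implicit Types (A : 'M[int]_d) (G : set 'rV[int]_d).

(* The basis vectors a_1, ..., a_d are the rows of A. *)
Definition lattice A : set 'rV[int]_d :=
  [set k *m A | k in [set: 'rV[int]_d]].

Definition full_rank A : Prop := row_free (map_mx intr A : 'M[R]_d).

Definition dual_lattice G : set 'rV[R]_d :=
  [set b | forall a, G a -> cis2pi (dotv b (intv a)) = 1].

Definition flip (j : 'I_d) (e : 'rV[R]_d) : 'rV[R]_d :=
  \row_i (if i == j then - e 0 i else e 0 i).

Definition divisible G : Prop :=
  forall e : 'rV[R]_d, (forall i, e 0 i = 1 \/ e 0 i = - 1) ->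
  forall j : 'I_d, exists2 p : nat, (2 <= p)%N &
    dual_lattice G (p%:R^-1 *: e) \/ dual_lattice G (p%:R^-1 *: flip j e).

(* Row j is b_j; see [dual_basisP]. *)
Definition dual_basis A : 'M[R]_d := (invmx (map_mx intr A))^T.

Definition dual_cell A : set 'rV[R]_d :=
  [set eta *m dual_basis A | eta in
   [set eta : 'rV[R]_d | forall j, 0 <= eta 0 j < 1]].

(* Lambda, the representatives of Z^d / Gamma. *)
Definition cell A : set 'rV[int]_d :=
  [set n | exists2 x : 'rV[R]_d, (forall j, 0 <= x 0 j < 1) &
           intv n = x *m map_mx intr A].

Definition reps A : {fset 'rV[int]_d} := fset_set (cell A).

(* N; [reps] is the honest set of representatives by [finite_cell]. *)
Definition nbands A : nat := #|` reps A|%fset.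

Definition rep A (i : 'I_(nbands A)) : 'rV[int]_d := nth 0 (reps A) i.

End Lattice.

Section Schrodinger.
Variables (R : realType) (d : nat).
Implicit Types (A : 'M[int]_d) (V : 'rV[int]_d -> R).
Implicit Types (psi : 'rV[int]_d -> R[i]) (theta : 'rV[R]_d).

Definition l1norm (n : 'rV[int]_d) : int := \sum_i `|n 0 i|.

Definition periodic_potential (G : set 'rV[int]_d) V : Prop :=
  forall n a, G a -> V (n + a) = V n.

Definition schrodinger V psi : 'rV[int]_d -> R[i] := fun n =>
  \sum_(m \in [set m | l1norm (m - n) = 1]) psi m
    + real_complex R (V n) * psi n.

(* The space l^2_theta(Z^d / Gamma). *)
Definition quasi_periodic (G : set 'rV[int]_d) theta : set ('rV[int]_d -> R[i]) :=
  [set psi | forall n a, G a ->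
             psi (n + a) = cis2pi (dotv theta (intv a)) * psi n].

(* The element of l^2_theta whose restriction to the cell is the indicator of
   the representative m. *)
Definition bloch A theta (m n : 'rV[int]_d) : R[i] :=
  if `[< lattice A (n - m) >] then cis2pi (dotv theta (intv (n - m))) else 0.

(* The matrix of h(theta), i.e. of H on l^2_theta, in the basis
   [bloch A theta (rep j)]; see [floquet_mxE]. *)
Definition floquet_mx A V theta : 'M[R[i]]_(nbands R A) :=
  \matrix_(i, j) schrodinger V (bloch A theta (rep j)) (rep i).

(* The j-th smallest eigenvalue of h(theta), with j counted from 0. [Re] loses
   nothing by [floquet_hermitian]; multiplicities are right by
   [char_poly_floquet]. *)
Definition band A V (j : 'I_(nbands R A)) theta : R :=
  nth 0 (sort <=%R [seq complex.Re (spectral_diag (floquet_mx A V theta) 0 i) |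
                    i <- enum 'I_(nbands R A)]) j.

(* E_j^- and E_j^+; the infimum and supremum are attained. *)
Definition band_min A V (j : 'I_(nbands R A)) : R := inf (range (band V j)).
Definition band_max A V (j : 'I_(nbands R A)) : R := sup (range (band V j)).

End Schrodinger.

Section LatticeFacts.
Variables (R : realType) (d : nat).
Implicit Types (A : 'M[int]_d).
Local Notation toR A := (map_mx intr A : 'M[R]_d).

Lemma dual_basisP A i j : full_rank R A ->
  dotv (intv (row i A)) (row j (dual_basis R A)) = (i == j)%:R.
Proof.
rewrite /full_rank row_free_unit => uA.
transitivity ((toR A *m invmx (toR A)) i j); last by rewrite mulmxV // !mxE.
by rewrite mxE; apply: eq_bigr => k _; rewrite !mxE.
Qed.

Lemma intvD (m n : 'rV[int]_d) : intv (m + n) = intv m + intv n :> 'rV[R]_d.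
Proof. by apply/rowP => i; rewrite !mxE intrD. Qed.

Lemma intvN (n : 'rV[int]_d) : intv (- n) = - intv n :> 'rV[R]_d.
Proof. by apply/rowP => i; rewrite !mxE intrN. Qed.

Lemma latticeB A m n : lattice A m -> lattice A n -> lattice A (m - n).
Proof. by move=> [k _ <-] [l _ <-]; exists (k - l) => //; rewrite mulmxBl. Qed.

Lemma lattice0 A : lattice A 0.
Proof. by exists 0 => //; rewrite mul0mx. Qed.

Lemma latticeN A n : lattice A n -> lattice A (- n).
Proof. by move=> h; rewrite -sub0r; apply: latticeB => //; exact: lattice0. Qed.

Lemma latticeD A m n : lattice A m -> lattice A n -> lattice A (m + n).
Proof. by move=> hm hn; rewrite -[n]opprK; apply/latticeB/latticeN. Qed.

Lemma finite_box (K : nat) :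
  finite_set [set n : 'rV[int]_d | forall i, `|n 0 i| <= K%:Z].
Proof.
pose f (g : {ffun 'I_d -> 'I_(K + K).+1}) : 'rV[int]_d :=
  \row_i ((g i : nat)%:Z - K%:Z).
apply: (@sub_finite_set _ _ (f @` [set: {ffun 'I_d -> 'I_(K + K).+1}])); last first.
  exact/finite_image/finite_finset.
move=> n /= hn; exists [ffun i => inord (absz (n 0 i + K%:Z)%R)] => //.
apply/rowP => i; rewrite mxE ffunE.
have := hn i; rewrite ler_norml => /andP[h1 h2].
have h3 : 0 <= n 0 i + K%:Z by rewrite -lerBlDr sub0r.
rewrite inordK ?gez0_abs ?addrK //.
rewrite ltnS -lez_nat gez0_abs // PoszD lerD2r //.
Qed.

Lemma finite_cell A : finite_set (cell R A).
Proof.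
pose K := \sum_i \sum_j `|A j i|%N.
apply: (sub_finite_set _ (finite_box K)) => n /= [x hx hn] i.
have {}hn : (n 0 i)%:~R = (x *m toR A) 0 i by rewrite -hn mxE.
rewrite -(ler_int R) intr_norm hn mxE.
apply: le_trans (ler_norm_sum _ _ _) _.
have -> : K%:Z%:~R = \sum_i \sum_j `|(A j i)%:~R| :> R.
  rewrite /K -pmulrn natr_sum; apply: eq_bigr => k _.
  by rewrite natr_sum; apply: eq_bigr => l _; rewrite -intr_norm -abszE.
rewrite [leRHS](bigD1 i) //= -[leLHS]addr0 lerD //; last first.
  by apply: sumr_ge0 => k _; apply: sumr_ge0.
apply: ler_sum => k _; rewrite mxE normrM -[leRHS]mul1r ler_wpM2r //.
by have /andP[h0 h1] := hx k; rewrite ger0_norm // ltW.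
Qed.

Lemma mem_reps A n : (n \in reps R A) = (n \in cell R A).
Proof. by rewrite in_fset_set //; exact: finite_cell. Qed.

Lemma cell_rep A (i : 'I_(nbands R A)) : cell R A (rep i).
Proof. by apply/set_mem; rewrite -mem_reps mem_nth. Qed.

Lemma rep_inj A : injective (@rep R d A).
Proof.
move=> i j /eqP; rewrite nth_uniq ?fset_uniq //.
by move=> /eqP /val_inj.
Qed.

Lemma cell_uniq A m n : full_rank R A ->
  cell R A m -> cell R A n -> lattice A (m - n) -> m = n.
Proof.
rewrite /full_rank row_free_unit => uA [x hx hm] [y hy hn] [k _ hk].
have e : intv k = x - y.
  apply: (can_inj (mulmxK uA)); rewrite mulmxBl -hm -hn -intvN -intvD -hk.
  by rewrite /intv map_mxM.
apply/eqP; rewrite -subr_eq0 -hk; apply/eqP.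
suff -> : k = 0 by rewrite mul0mx.
apply/rowP => i; rewrite mxE.
have := congr1 (fun z : 'rV[R]_d => z 0 i) e; rewrite !mxE => {}e.
have /andP[x0 x1] := hx i; have /andP[y0 y1] := hy i.
have k1 : k 0 i < 1 by rewrite -(ltr_int R) e; lra.
have k2 : - 1 < k 0 i by rewrite -(ltr_int R) e; lra.
lia.
Qed.

Lemma ex_rep A n : full_rank R A ->
  exists i : 'I_(nbands R A), lattice A (n - rep i).
Proof.
rewrite /full_rank row_free_unit => uA.
pose y := intv n *m invmx (toR A).
pose k : 'rV[int]_d := \row_i Num.floor (y 0 i).
have hm : cell R A (n - k *m A).
  exists (y - intv k).
    move=> j; rewrite mxE [X in _ + X]mxE [X in - X]mxE [X in _ - X%:~R]mxE.
    by have := floor_itv (y 0 j); rewrite intrD; lra.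
  rewrite mulmxBl mulmxKV // intvD intvN; congr (_ - _).
  by rewrite /intv map_mxM.
have : (n - k *m A) \in (reps R A : seq _) by rewrite mem_reps inE.
move=> /(nthP 0)[i lti ei]; exists (Ordinal lti).
by rewrite /rep ei opprB addrC subrK; exists k.
Qed.

End LatticeFacts.

Section SchrodingerFacts.
Variables (R : realType) (d : nat).
Implicit Types (A : 'M[int]_d) (V : 'rV[int]_d -> R).
Implicit Types (psi : 'rV[int]_d -> R[i]) (theta : 'rV[R]_d).

Lemma cis2piD (s t : R) : cis2pi (s + t) = cis2pi s * cis2pi t.
Proof.
rewrite /cis2pi mulrDr cosD sinD; congr Complex.
by rewrite addrC; congr (_ + _); exact: mulrC.
Qed.

Lemma cis2pi0 : cis2pi (0 : R) = 1.
Proof. by rewrite /cis2pi mulr0 cos0 sin0. Qed.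

Lemma conjc_cis2pi (t : R) : conjc (cis2pi t) = cis2pi (- t).
Proof. by rewrite /cis2pi mulrN cosN sinN. Qed.

Lemma dotvDr (x y z : 'rV[R]_d) : dotv x (y + z) = dotv x y + dotv x z.
Proof.
by rewrite -big_split; apply: eq_bigr => i _; rewrite mxE mulrDr.
Qed.

Lemma dotvNr (x y : 'rV[R]_d) : dotv x (- y) = - dotv x y.
Proof. by rewrite -sumrN; apply: eq_bigr => i _; rewrite mxE mulrN. Qed.

Lemma l1normN (n : 'rV[int]_d) : l1norm (- n) = l1norm n.
Proof. by apply: eq_bigr => i _; rewrite mxE normrN. Qed.

Lemma finite_nbhd (n : 'rV[int]_d) : finite_set [set m | l1norm (m - n) = 1].
Proof.
apply: (@sub_finite_set _ _ ((+%R n) @`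
  [set m : 'rV[int]_d | forall i, `|m 0 i| <= 1%:Z])); last first.
  exact/finite_image/finite_box.
move=> m /= hm; exists (m - n); last by rewrite addrC subrK.
move=> i; apply: (@le_trans _ _ (l1norm (m - n))); last by rewrite hm.
by rewrite /l1norm [leRHS](bigD1 i) //= lerDl sumr_ge0.
Qed.

Lemma schrodinger_sum V (I : finType) (c : I -> R[i])
    (f : I -> 'rV[int]_d -> R[i]) n :
  schrodinger V (fun m => \sum_i c i * f i m) n =
  \sum_i c i * schrodinger V (f i) n.
Proof.
rewrite /schrodinger; have fN := finite_nbhd n.
under [RHS]eq_bigr do rewrite mulrDr.
rewrite big_split /=; congr (_ + _).
  under [RHS]eq_bigr => i _ do rewrite fsbig_finite // mulr_sumr.
  by rewrite fsbig_finite // exchange_big.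
by rewrite mulr_sumr; apply: eq_bigr => i _; rewrite mulrCA.
Qed.

Lemma schrodinger_quasi_periodic A V theta psi :
  periodic_potential (lattice A) V -> quasi_periodic (lattice A) theta psi ->
  quasi_periodic (lattice A) theta (schrodinger V psi).
Proof.
move=> hV hpsi n a ha; rewrite /schrodinger hV // hpsi // mulrDr mulrCA.
congr (_ + _).
rewrite (@reindex_fsbig _ _ _ _ _ (fun m => m + a) [set m | l1norm (m - n) = 1]).
  rewrite !(fsbig_finite _ _ (finite_nbhd n)) mulr_sumr /=.
  by apply: eq_bigr => m _; exact: hpsi.
split.
- by move=> m /=; rewrite opprD addrACA subrr addr0.
- by move=> m m' _ _; exact: addIr.
- move=> m /= hm; exists (m - a); last by rewrite subrK.
  by rewrite /= -addrA -opprD [a + n]addrC.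
Qed.

Lemma bloch_quasi_periodic A theta m :
  quasi_periodic (lattice A) theta (bloch A theta m).
Proof.
move=> n a ha; rewrite /bloch addrAC.
have -> : lattice A (n - m + a) = lattice A (n - m).
  apply/propext; split => h; last exact: latticeD.
  by rewrite -(addrK a (n - m)); exact: latticeB.
case: ifP => _; last by rewrite mulr0.
by rewrite [in LHS]intvD dotvDr cis2piD mulrC.
Qed.

Lemma bloch_rep A theta i j : full_rank R A ->
  bloch A theta (rep j) (rep i : 'rV_d) = (i == j :> 'I_(nbands R A))%:R.
Proof.
move=> rA; rewrite /bloch; case: asboolP => [h|].
  have ij := rep_inj (cell_uniq rA (cell_rep i) (cell_rep j) h); rewrite {}ij {h}.
  rewrite eqxx subrr; have -> : intv 0 = 0 :> 'rV[R]_d.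
    by apply/rowP => k; rewrite !mxE.
  by rewrite /dotv big1 ?cis2pi0 // => k _; rewrite mxE mulr0.
by case: eqP => // -> []; rewrite subrr; exact: lattice0.
Qed.

Lemma quasi_periodic_bloch A theta psi n : full_rank R A ->
  quasi_periodic (lattice A) theta psi ->
  psi n = \sum_(j < nbands R A) psi (rep j) * bloch A theta (rep j) n.
Proof.
move=> rA hpsi; have [i hi] := ex_rep n rA.
have e f : quasi_periodic (lattice A) theta f ->
    f n = cis2pi (dotv theta (intv (n - rep i))) * f (rep i).
  by move=> hf; rewrite -hf // addrC subrK.
rewrite e // (bigD1 i) //= big1 ?addr0 => [|j ji].
  rewrite (e (bloch _ _ _)); last exact: bloch_quasi_periodic.
  by rewrite bloch_rep // eqxx mulr1 mulrC.
rewrite (e (bloch _ _ _)); last exact: bloch_quasi_periodic.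
by rewrite bloch_rep // eq_sym (negPf ji) !mulr0.
Qed.

Lemma floquet_mxE A V theta psi i : full_rank R A ->
  quasi_periodic (lattice A) theta psi ->
  schrodinger V psi (rep i) =
  \sum_(j < nbands R A) floquet_mx A V theta i j * psi (rep j).
Proof.
move=> rA hpsi.
have -> : psi = fun m =>
    \sum_(j < nbands R A) psi (rep j) * bloch A theta (rep j) m.
  by apply/funext => m; exact: quasi_periodic_bloch.
rewrite schrodinger_sum; apply: eq_bigr => j _; rewrite mxE mulrC.
by congr (_ * _); rewrite -quasi_periodic_bloch.
Qed.

Lemma bloch_sym A theta m n :
  conjc (bloch A theta m n) = bloch A theta n m.
Proof.
rewrite /bloch.
have -> : lattice A (n - m) = lattice A (m - n).
  by apply/propext; split => /latticeN; rewrite opprB.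
case: ifP => _; last by rewrite conjc0.
by rewrite conjc_cis2pi -dotvNr -intvN opprB.
Qed.

Lemma floquet_hermitian A V theta : full_rank R A ->
  floquet_mx A V theta \is hermsymmx.
Proof.
move=> rA; apply/is_hermitianmxP; rewrite expr0 scale1r.
have cE (z : R[i]) : Num.conj z = conjc z by [].
apply/matrixP => i j; rewrite !mxE cE /schrodinger rmorphD rmorphM /=.
congr (_ + _); last first.
  rewrite !bloch_rep // [in RHS]eq_sym; case: eqP => [->|_].
    by rewrite conjc1 oppr0.
  by rewrite !mulr0 conjc0 mulr0.
rewrite (fsbig_finite _ _ (finite_nbhd (rep j))) rmorph_sum /=.
rewrite -(fsbig_finite _ _ (finite_nbhd (rep j))).
rewrite (@reindex_fsbig _ _ _ _ _ (fun m => rep i + rep j - m)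
   [set m | l1norm (m - rep j) = 1]).
  apply: eq_fsbigr => m _.
  rewrite bloch_sym /bloch.
  by rewrite addrAC addrK.
split.
- by move=> m /= <-; rewrite addrAC [rep i + _]addrC addrK -l1normN opprB.
- by move=> m m' _ _ /addrI /oppr_inj.
- move=> m /= hm; exists (rep i + rep j - m); last by rewrite opprB addrC subrK.
  by rewrite /= addrAC addrK -l1normN opprB.
Qed.

Lemma char_poly_floquet A V theta : full_rank R A ->
  char_poly (floquet_mx A V theta) =
  \prod_(j < nbands R A) ('X - (real_complex R (band V j theta))%:P).
Proof.
move=> rA; have hM := floquet_hermitian V theta rA.
set M := floquet_mx A V theta in hM *.
have uP : spectralmx M \in unitmx by exact: spectral_unit.
have sE := orthomx_spectralP (hermitian_normalmx hM).
have sR := hermitian_spectral_diag_real hM.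
transitivity (char_poly (diag_mx (spectral_diag M))).
  rewrite /char_poly [in LHS]sE /char_poly_mx.
  set P := spectralmx M; set D := diag_mx _.
  have PV : map_mx polyC (invmx P) *m map_mx polyC P = 1%:M.
    by rewrite -map_mxM mulVmx // map_mx1.
  rewrite !map_mxM.
  have -> : 'X%:M - map_mx polyC (invmx P) *m map_mx polyC D *m map_mx polyC P =
     map_mx polyC (invmx P) *m ('X%:M - map_mx polyC D) *m map_mx polyC P.
    rewrite mulmxBr mulmxBl; congr (_ - _).
    by rewrite scalar_mxC -mulmxA PV mulmx1.
  by rewrite !det_mulmx mulrAC -det_mulmx PV det1 mul1r.
rewrite char_poly_trig; last first.
  by apply/is_trig_mxP => i j ij; rewrite mxE -val_eqE /= (ltn_eqF ij).
pose s := [seq complex.Re (spectral_diag M 0 i) | i <- enum 'I_(nbands R A)].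
transitivity (\prod_(x <- s) ('X - (real_complex R x)%:P)).
  rewrite big_map big_enum; apply: eq_bigr => i _.
  rewrite mxE eqxx mulr1n RRe_real //.
  exact: (mxOverP sR).
have -> : \prod_(x <- s) ('X - (real_complex R x)%:P) =
    \prod_(x <- sort <=%R s) ('X - (real_complex R x)%:P).
  by apply: perm_big; rewrite perm_sym perm_sort.
rewrite (big_nth 0) big_mkord size_sort size_map size_enum_ord.
by apply: eq_bigr.
Qed.

Lemma band_sorted A V theta (i j : 'I_(nbands R A)) :
  (i <= j)%N -> band V i theta <= band V j theta.
Proof.
move=> ij; apply: sorted_leq_nth => //; first exact: le_trans.
- exact: sort_le_sorted.
- by rewrite inE size_sort size_map size_enum_ord.
- by rewrite inE size_sort size_map size_enum_ord.
Qed.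

End SchrodingerFacts.

(* Main.v *)
Require Import Defs.
From HB Require Import structures.
From mathcomp Require Import all_boot all_order all_algebra.
From mathcomp Require Import all_classical all_reals all_analysis.
From mathcomp Require Import complex zify ring lra separable.

(** Indivisibility of [Gamma] provides a coordinate [j] and two sign vectors [eps],
    [eps'], differing only at [j], no proper fraction of which lies in the dual lattice.
    Put [z_k = exp (2 pi i theta_k)].  After a gauge transformation [h(theta) - lam]
    becomes [z_j S + S^-1 / z_j + W(z')], where [S] is a translation of [Z^d / Gamma] and
    [z'] collects the other variables, so the zeros in [z_j] of [det (h - lam)] are the
    eigenvalues of a [2N x 2N] transfer matrix and its characteristic polynomial is monic.
    Its discriminant is a Laurent polynomial in [z'] which is not identically zero: letting
    [z_k = (alpha_k / tau)^eps_k] with [tau -> 0], [N] of the roots are of order [1 / tau]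
    and [N] of order [tau], and their rescaled limits are linear forms in [alpha]
    indexed by the characters of [Z^d / Gamma]; two of these forms in the first (second)
    family coincide only if a proper fraction of [eps] ([eps']) is in the dual lattice.

    At a band edge [det (h - lam)] vanishes to second order along the direction [e_j], so
    [z_j] is a double root and [z'] a zero of the discriminant.  The level set thus lies in
    the common zero set of a trigonometric polynomial that is nonzero on every line
    parallel to [e_j] and one that is constant along [e_j] and not flat in some direction
    [v].  Where suitable derivatives in the directions [e_j] and [v] are bounded below,
    such a set is locally a Lipschitz graph over the remaining [d - 2] coordinates. *)

Set Implicit Arguments.
Unset Strict Implicit.
Unset Printing Implicit Defensive.

Import Order.TTheory GRing.Theory Num.Theory.
Import numFieldNormedType.Exports.
Import ComplexField.Normc.

Local Open Scope classical_set_scope.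
Local Open Scope ring_scope.

(** * Quadratic matrix pencils *)

Lemma det_pencil (K : comNzRingType) n (x : K) (P Q : 'M[K]_n) :
  \det (x%:M - block_mx 0 1%:M (- Q) (- P)) =
  \det ((x ^+ 2)%:M + x *: P + Q).
Proof.
have -> : x%:M - block_mx 0 1%:M (- Q) (- P) =
          block_mx x%:M (- 1%:M) Q (x%:M + P).
  by rewrite scalar_mx_block opp_block_mx add_block_mx !opprK !subr0 !add0r.
pose J : 'M[K]_(n + n) := block_mx 0 1%:M (- 1%:M) 0.
have dJ : \det J = 1.
  have -> : J = block_mx 1%:M 1%:M 0 1%:M *m block_mx 1%:M 0 (- 1%:M) 1%:M *m
                block_mx 1%:M 1%:M 0 1%:M.
    rewrite !mulmx_block !(mul1mx, mulmx1, mul0mx, mulmx0, addr0, add0r).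
    by rewrite addrN addNr add0r.
  by rewrite !det_mulmx !(det_ublock, det_lblock) !det1 !mulr1.
have h : block_mx 1%:M 0 (x%:M + P) 1%:M *m
    block_mx x%:M (- 1%:M) Q (x%:M + P) *m J =
  block_mx 1%:M x%:M 0 ((x ^+ 2)%:M + x *: P + Q).
  rewrite !mulmx_block !(mul1mx, mulmx1, mul0mx, mulmx0, addr0, add0r).
  rewrite !(mulmxN, mulNmx) !mulmx1 opprK addNr; congr block_mx.
  by rewrite oppr0.
  by rewrite mulmxDl -scalar_mxM -expr2 -mul_mx_scalar.
have := congr1 determinant h.
by rewrite !det_mulmx dJ det_lblock det_ublock !det1 !mul1r mulr1.
Qed.

Lemma horner_char_poly (K : comNzRingType) n (M : 'M[K]_n) x :
  (char_poly M).[x] = \det (x%:M - M).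
Proof.
rewrite /char_poly -horner_evalE -det_map_mx; congr determinant.
apply/matrixP => i k; rewrite !mxE /= horner_evalE.
by rewrite hornerD hornerN hornerC hornerMn hornerX.
Qed.

Section NumField.
Variable C : numFieldType.
Implicit Types (x y d e : C) (s : seq C).

Lemma pos_lower_bound (I : finType) (f : I -> C) :
  (forall i, 0 < f i) -> exists2 d, 0 < d & forall i, d <= f i.
Proof.
move=> f0.
have h0 : 0 <= \sum_i (f i)^-1 by apply: sumr_ge0 => i _; rewrite invr_ge0 ltW.
exists (1 + \sum_i (f i)^-1)^-1; first by rewrite invr_gt0 ltr_pwDl.
move=> i; rewrite -[leRHS]invrK lef_pV2 ?posrE ?invr_gt0 ?ltr_pwDl //.
rewrite (bigD1 i) //= addrCA lerDl addr_ge0 // sumr_ge0 // => k _.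
by rewrite invr_ge0 ltW.
Qed.

Lemma root_near s x d :
  0 < d -> `|\prod_(r <- s) (x - r)| < d ^+ size s ->
  exists2 r, r \in s & `|x - r| < d.
Proof.
move=> d0 h; have [/hasP|/hasPn far] := boolP (has (fun r => `|x - r| < d) s).
  by [].
suff : d ^+ size s <= `|\prod_(r <- s) (x - r)| by move=> /(lt_le_trans h); rewrite ltxx.
rewrite normr_prod; elim: s {h} far => [|r s IH] far; first by rewrite big_nil.
rewrite big_cons exprS ler_pM ?exprn_ge0 ?(ltW d0) //.
  by rewrite real_leNgt ?normr_real ?(gtr0_real d0) // far ?mem_head.
by apply: IH => z zs; apply: far; rewrite inE zs orbT.
Qed.

Lemma poly_bounded (p : {poly C}) :
  exists2 b, 0 < b & forall x, `|x| <= 1 -> `|p.[x]| <= b.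
Proof.
exists (1 + \sum_(i < size p) `|p`_i|).
  by rewrite ltr_pwDl // sumr_ge0.
move=> x x1; rewrite horner_coef (le_trans (ler_norm_sum _ _ _)) //.
rewrite -[leLHS]add0r lerD // ler_sum // => i _.
by rewrite normrM normrX ler_piMr // exprn_ile1.
Qed.

Lemma poly_small (p : {poly C}) e : p.[0] = 0 -> 0 < e ->
  exists2 t0, 0 < t0 & forall t, 0 < t -> t < t0 -> `|p.[t]| < e.
Proof.
move=> /rootP/factor_theorem[q ->] e0; have [b b0 hb] := poly_bounded q.
have [t0 t00 ht0] : exists2 d, 0 < d & forall i : bool, d <= if i then 1 else e / b.
  by apply: pos_lower_bound => -[]; rewrite ?divr_gt0.
exists t0 => // t t_gt0 tt0; rewrite hornerM hornerXsubC subr0 normrM (gtr0_norm t_gt0).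
apply: (@le_lt_trans _ _ (b * t)).
  rewrite ler_wpM2r ?(ltW t_gt0) // hb // gtr0_norm //.
  exact: le_trans (ltW tt0) (ht0 true).
by rewrite mulrC -ltr_pdivlMr //; exact: lt_le_trans tt0 (ht0 false).
Qed.

Lemma det_small n (M0 M1 M2 : 'M[C]_n) e : \det M0 = 0 -> 0 < e ->
  exists2 t0, 0 < t0 & forall t, 0 < t -> t < t0 ->
    `|\det (M0 + t *: M1 + t ^+ 2 *: M2)| < e.
Proof.
move=> M00 e0.
pose p : {poly C} := \det (map_mx polyC M0 + 'X *: map_mx polyC M1
  + 'X ^+ 2 *: map_mx polyC M2).
have pE t : p.[t] = \det (M0 + t *: M1 + t ^+ 2 *: M2).
  rewrite /p -horner_evalE -det_map_mx; congr determinant.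
  by apply/matrixP => i k; rewrite !mxE /= horner_evalE !hornerE.
have [|t0 t00 ht0] := @poly_small p _ _ e0.
  by rewrite pE expr0n !scale0r !addr0.
by exists t0 => // t t1 t2; rewrite -pE; exact: ht0.
Qed.

End NumField.

Section Pencil.
Variable C : numClosedFieldType.

Lemma separation N (f : 'I_N -> C) : injective f -> (forall i, f i != 0) ->
  exists2 d, 0 < d & forall i, d + d <= `|f i| /\
    forall k, k != i -> d + d <= `|f i - f k|.
Proof.
move=> injf f0.
have [d d0 hd] : exists2 d, 0 < d & forall ik : 'I_N * 'I_N,
    d <= if ik.1 == ik.2 then `|f ik.1| else `|f ik.1 - f ik.2|.
  apply: pos_lower_bound => -[i k] /=; case: eqP => [_|/eqP ik].
    by rewrite normr_gt0.
  by rewrite normr_gt0 subr_eq0; apply: contra ik => /eqP/injf ->.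
exists (d / 2%:R); first by rewrite divr_gt0 ?ltr0n.
move=> i; have -> : d / 2%:R + d / 2%:R = d by field.
split=> [|k ki]; first by have := hd (i, i); rewrite eqxx.
by have := hd (i, k); rewrite /= eq_sym (negPf ki).
Qed.

Lemma near_roots N (f : 'I_N -> C) (d : C) s :
  0 < d ->
  (forall i, d + d <= `|f i| /\ forall k, k != i -> d + d <= `|f i - f k|) ->
  (forall i, `|\prod_(r <- s) (f i - r)| < d ^+ size s) ->
  exists g : 'I_N -> C, [/\ forall i, g i \in s, injective g &
    forall i, d <= `|g i|].
Proof.
move=> d0 hd hs.
have close i : {r : C | r \in s /\ `|f i - r| < d}.
  have /hasP/sig2W[r rs hr] : has (fun r => `|f i - r| < d) s.
    by have [r rs hr] := root_near d0 (hs i); apply/hasP; exists r.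
  by exists r.
exists (fun i => sval (close i)); split=> [i|i k eik|i].
- by case: (svalP (close i)).
- apply/eqP; apply/negP => /negP; rewrite eq_sym => ik.
  have [_ /(_ k ik)] := hd i.
  have [_ hi] := svalP (close i); have [_ hk] := svalP (close k).
  have -> : f i - f k = (f i - sval (close i)) - (f k - sval (close k)).
    by rewrite eik opprB addrA subrK.
  by move=> /le_trans/(_ (ler_normB _ _)) /le_lt_trans/(_ (ltrD hi hk)); rewrite ltxx.
- have [h _] := hd i; have [_ hi] := svalP (close i).
  have h2 := le_lt_trans (lerB_dist (f i) (sval (close i))) hi.
  rewrite -(lerD2l d); apply: le_trans h _.
  by rewrite -lerBlDr ltW.
Qed.

(* Of the 2N roots r, N have t r close to the xi_i and N have t / r close to the zeta_i. *)
Lemma separable_pencil N (P0 P1 P2 Q : 'M[C]_N) (xi zeta : 'I_N -> C) :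
  \det Q != 0 ->
  injective xi -> (forall i, xi i != 0) ->
  (forall i, \det ((xi i)%:M + P0) = 0) ->
  injective zeta -> (forall i, zeta i != 0) ->
  (forall i, \det (zeta i *: Q + P0) = 0) ->
  exists2 t : C, 0 < t & separable_poly (char_poly
    (block_mx 0 1%:M (- Q) (- (t^-1 *: P0 + P1 + t *: P2)))).
Proof.
move=> Q0 xi_inj xi0 xiP zeta_inj zeta0 zetaP.
have [d d0 hd] := separation xi_inj xi0.
have [e e0 he] := separation zeta_inj zeta0.
have [t [t0 td htxi htzeta]] : exists t : C, [/\ 0 < t, t ^+ 2 < d * e,
   forall i, `|\det (xi i *: ((xi i)%:M + P0) + t *: (xi i *: P1)
      + t ^+ 2 *: (xi i *: P2 + Q))| < d ^+ (N + N) &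
   forall i, `|\det (zeta i *: (zeta i *: Q + P0) + t *: (zeta i *: P1)
      + t ^+ 2 *: (1%:M + zeta i *: P2))| < `|\det Q| * e ^+ (N + N)].
  have fam (f : 'I_N -> 'M[C]_N) g h b : (forall i, \det (f i) = 0) -> 0 < b ->
      exists2 t0 : C, 0 < t0 & forall t, 0 < t -> t < t0 ->
      forall i, `|\det (f i + t *: g i + t ^+ 2 *: h i)| < b.
    move=> f0 b0.
    have w i : {t0 : C | 0 < t0 & forall t, 0 < t -> t < t0 ->
        `|\det (f i + t *: g i + t ^+ 2 *: h i)| < b}.
      by apply/cid2/det_small.
    have [t0 t00 ht0] := pos_lower_bound (fun i => s2valP (w i)).
    exists t0 => // t t1 t2 i; apply: (s2valP' (w i)) => //.
    exact: lt_le_trans t2 (ht0 i).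
  have [||t1 t1_gt0 ht1] := fam (fun i => xi i *: ((xi i)%:M + P0))
     (fun i => xi i *: P1) (fun i => xi i *: P2 + Q) (d ^+ (N + N)).
  - by move=> i; rewrite detZ xiP mulr0.
  - by rewrite exprn_gt0.
  have [||t2 t2_gt0 ht2] := fam (fun i => zeta i *: (zeta i *: Q + P0))
     (fun i => zeta i *: P1) (fun i => 1%:M + zeta i *: P2) (`|\det Q| * e ^+ (N + N)).
  - by move=> i; rewrite detZ zetaP mulr0.
  - by rewrite mulr_gt0 ?normr_gt0 ?exprn_gt0.
  have [t t_gt0 ht] : exists2 t : C, 0 < t & forall i : 'I_4,
     t <= nth 1 [:: t1; t2; 1; d * e] i.
    apply: pos_lower_bound => -[[|[|[|[|//]]]] lti] //=; exact: mulr_gt0.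
  have t2lt : t / 2%:R < t by rewrite ltr_pdivrMr ?ltr0n // ltr_pMr // ltr1n.
  have t2pos : 0 < t / 2%:R by rewrite divr_gt0 ?ltr0n.
  exists (t / 2%:R); split => //.
  - have ht1' := ht (@Ordinal 4 2 isT); have htd := ht (@Ordinal 4 3 isT).
    apply: lt_le_trans htd; rewrite expr2 /=; apply: (le_lt_trans _ t2lt).
    by rewrite ler_piMr ?(ltW t2pos) //; exact: le_trans (ltW t2lt) ht1'.
  - by apply: ht1 => //; apply: lt_le_trans t2lt (ht (@Ordinal 4 0 isT)).
  - by apply: ht2 => //; apply: lt_le_trans t2lt (ht (@Ordinal 4 1 isT)).
exists t => //; set M := block_mx _ _ _ _.
have tn0 : t != 0 by rewrite gt_eqF.
have [s ps] := closed_field_poly_normal (char_poly M).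
rewrite (monicP (char_poly_monic M)) scale1r in ps.
have sz : size s = (N + N)%N.
  by apply: succn_inj; rewrite -(size_char_poly M) ps size_prod_XsubC.
have pE x : \prod_(r <- s) (x - r) =
    \det ((x ^+ 2)%:M + x *: (t^-1 *: P0 + P1 + t *: P2) + Q).
  rewrite -det_pencil -horner_char_poly ps horner_prod.
  by apply: eq_bigr => r _; rewrite !hornerE.
have s0 r : r \in s -> r != 0.
  move=> rs; apply: contraNneq Q0 => r0; have := pE 0.
  rewrite expr0n scale0r addr0 raddf0 add0r => <-.
  by rewrite prodf_seq_eq0; apply/hasP; exists r; rewrite //= r0 subrr.
rewrite ps separable_prod_XsubC.
have prods (u : C) : u ^+ (N + N) = \prod_(r <- s) u.
  by rewrite big_const_seq count_predT sz iter_mulr_1.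
have detZ2 (u : C) (M1 : 'M[C]_N) : u ^+ (N + N) * \det M1 = \det (u ^+ 2 *: M1).
  by rewrite detZ -exprM mul2n addnn.
have [|g [gs g_inj gd]] := @near_roots _ xi d [seq t * r | r <- s] d0 hd.
  move=> i; rewrite size_map sz big_map; apply: le_lt_trans (htxi i).
  have -> : \prod_(r <- s) (xi i - t * r) =
            t ^+ (N + N) * \prod_(r <- s) (xi i / t - r).
    rewrite prods -big_split /=.
    by apply: eq_bigr => r _; rewrite mulrBr mulrCA divff ?mulr1.
  rewrite pE detZ2 le_eqVlt; apply/orP; left; apply/eqP; congr (`|\det _|).
  apply/matrixP => a b; rewrite !mxE; case: (a == b); rewrite ?mulr1n ?mulr0n.
    by field.
  by field.
have [|h [hs h_inj hd']] := @near_roots _ zeta e [seq t / r | r <- s] e0 he.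
  move=> i; rewrite size_map sz big_map.
  have -> : \prod_(r <- s) (zeta i - t / r) =
            (\prod_(r <- s) (- r))^-1 * \prod_(r <- s) (t - zeta i * r).
    rewrite -prodfV -big_split /= big_seq [RHS]big_seq.
    by apply: eq_bigr => r /s0 rs0; field.
  have -> : \prod_(r <- s) (- r) = \det Q.
    transitivity (\prod_(r <- s) (0 - r)).
      by apply: eq_bigr => r _; rewrite sub0r.
    by rewrite pE expr0n scale0r addr0 raddf0 add0r.
  have -> : \prod_(r <- s) (t - zeta i * r) =
            zeta i ^+ (N + N) * \prod_(r <- s) (t / zeta i - r).
    rewrite prods -big_split /=.
    by apply: eq_bigr => r _; rewrite mulrBr mulrCA divff ?mulr1.
  rewrite normrM normfV mulrC ltr_pdivrMr ?normr_gt0 // [ltRHS]mulrC.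
  apply: le_lt_trans (htzeta i).
  rewrite pE detZ2 le_eqVlt; apply/orP; left; apply/eqP; congr (`|\det _|).
  apply/matrixP => a b; rewrite !mxE; case: (a == b); rewrite ?mulr1n ?mulr0n.
    by field; rewrite ?tn0 ?zeta0.
  by field; rewrite ?tn0 ?zeta0.
pose u := [seq g i / t | i : 'I_N] ++ [seq t / h i | i : 'I_N].
apply: (@leq_size_uniq _ u).
- have inj1 : injective (fun i => g i / t).
    by move=> i k /(mulIf (invr_neq0 tn0)) /g_inj.
  have inj2 : injective (fun i => t / h i).
    by move=> i k /(mulfI tn0)/invr_inj/h_inj.
  rewrite cat_uniq !map_inj_uniq -?enumT ?enum_uniq // andbT /=; apply/hasPn => _ /mapP[i _ ->]; apply/negP => /mapP[k _ eik].
  have hk0 : h i != 0 by rewrite -normr_gt0 (lt_le_trans e0).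
  have : g k * h i = t ^+ 2.
    by rewrite -(mulfVK tn0 (g k)) -eik; field.
  move=> /(congr1 Num.norm); rewrite normrM normrX (gtr0_norm t0) => gh.
  have := ler_pM (ltW d0) (ltW e0) (gd k) (hd' i).
  by rewrite gh => /(lt_le_trans td); rewrite ltxx.
- move=> r; rewrite mem_cat => /orP[] /mapP[i _ ->].
    by have /mapP[r' r's ->] := gs i; rewrite mulrAC divff // mul1r.
  have /mapP[r' r's ->] := hs i.
  by rewrite invf_div mulrCA divff // mulr1.
- by rewrite size_cat !size_map -enumT size_enum_ord sz.
Qed.

End Pencil.

(** * Translations on the quotient and their joint spectrum *)

Ltac vec := by apply/rowP => ?; rewrite !mxE; ring.

Section Shift.
Variables (R : realType) (d : nat) (A : 'M[int]_d).
Hypothesis rkA : full_rank R A.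
Notation N := (nbands R A).
Notation C := R[i].
Implicit Types (m n a : 'rV[int]_d) (i k l : 'I_N).

Definition shift_mx n : 'M[C]_N :=
  \matrix_(i, k) (`[< lattice A (rep i + n - rep k) >])%:R.

Lemma lattice_subl m n : lattice A (m - n) -> forall a, lattice A (m + a) = lattice A (n + a).
Proof.
move=> mn a; apply/propext; split => h.
  have -> : n + a = (m + a) - (m - n) by vec.
  exact: latticeB.
have -> : m + a = (n + a) + (m - n) by vec.
exact: latticeD.
Qed.

Lemma rep_eq i k : lattice A (rep i - rep k) -> i = k.
Proof. by move=> h; apply: rep_inj; exact: cell_uniq rkA (cell_rep i) (cell_rep k) h. Qed.

Lemma shift_lattice a : lattice A a -> shift_mx a = 1%:M.
Proof.
move=> ha; apply/matrixP => i k; rewrite !mxE; congr ((_ : bool)%:R).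
apply/asboolP/eqP => [h|->]; last by rewrite addrAC subrr add0r.
apply: rep_eq; have -> : rep i - rep k = (rep i + a - rep k) - a by vec.
exact: latticeB.
Qed.

Lemma shift_mx0 : shift_mx 0 = 1%:M.
Proof. by apply: shift_lattice; exact: lattice0. Qed.

Lemma shift_mxE n i k l : lattice A (rep i + n - rep k) -> shift_mx n i l = (k == l)%:R.
Proof.
move=> h; rewrite mxE; congr ((_ : bool)%:R); rewrite (lattice_subl h).
by apply/asboolP/eqP => [/rep_eq|->]; rewrite ?subrr //; exact: lattice0.
Qed.

Lemma shift_mxD m n : shift_mx (m + n) = shift_mx m *m shift_mx n.
Proof.
apply/matrixP => i l; rewrite [RHS]mxE.
have [k hk] := ex_rep (rep i + m) rkA.
rewrite (bigD1 k) //= big1 => [|k' k'k].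
  rewrite addr0 (shift_mxE _ hk) eqxx mul1r !mxE addrA.
  by congr (`[< _ >]%:R); rewrite -!addrA [_ + (m + _)]addrA; exact: lattice_subl.
by rewrite (shift_mxE _ hk) eq_sym (negPf k'k) mul0r.
Qed.

Lemma shift_unit n : shift_mx n *m shift_mx (- n) = 1%:M.
Proof. by rewrite -shift_mxD subrr shift_mx0. Qed.

Lemma det_shift n : \det (shift_mx n) != 0.
Proof.
have := congr1 determinant (shift_unit n); rewrite det_mulmx det1.
by apply: contra_eq_neq => ->; rewrite mul0r eq_sym oner_eq0.
Qed.

Lemma trmx_shift n : (shift_mx n)^T = shift_mx (- n).
Proof.
apply/matrixP => i k; rewrite !mxE; congr ((_ : bool)%:R).
have -> : rep i + - n - rep k = - (rep k + n - rep i) by vec.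
by apply/asboolP/asboolP => /latticeN; rewrite ?opprK.
Qed.

Lemma shift_comm m n : comm_mx (shift_mx m) (shift_mx n).
Proof. by rewrite /comm_mx -!shift_mxD addrC. Qed.

Lemma shift_normal n : shift_mx n \is normalmx.
Proof.
apply/normalmxP.
have -> : map_mx Num.conj (shift_mx n)^T = shift_mx (- n).
  rewrite trmx_shift; apply/matrixP => i k; rewrite !mxE.
  by rewrite rmorph_nat.
exact: shift_comm.
Qed.

Lemma shift_diagonalizable n : diagonalizable (shift_mx n).
Proof.
exists (spectralmx (shift_mx n)); first exact: spectral_unit.
apply/diagonalizable_forPex; exists (spectral_diag (shift_mx n)).
apply/simmxP; first exact: spectral_unit.
rewrite {2}(orthomx_spectralP (shift_normal n)) !mulmxA mulmxV ?mul1mx //.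
exact: spectral_unit.
Qed.

Lemma joint_spectrum : exists2 P : 'M[C]_N, P \in unitmx &
  exists chi : 'I_N -> 'rV[int]_d -> C,
  forall n, P *m shift_mx n = diag_mx (\row_i chi i n) *m P.
Proof.
have : codiagonalizable [seq shift_mx (rep k) | k <- enum 'I_N].
  apply/codiagonalizableP; split.
    by move=> _ _ /mapP[k _ ->] /mapP[l _ ->]; exact: shift_comm.
  by move=> _ /mapP[k _ ->]; exact: shift_diagonalizable.
move=> [P uP /allP hP]; exists P => //.
have ex n : {D | P *m shift_mx n = diag_mx D *m P}.
  apply: cid; have [k hk] := ex_rep n rkA.
  have -> : shift_mx n = shift_mx (rep k).
    have -> : n = rep k + (n - rep k) by vec.
    by rewrite shift_mxD (shift_lattice hk) mulmx1.
  have /hP/diagonalizable_forPex[D /(simmxP uP)] :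
    shift_mx (rep k) \in [seq shift_mx (rep k) | k <- enum 'I_N].
    by apply: map_f; rewrite mem_enum.
  by exists D.
exists (fun i n => sval (ex n) 0 i) => n; rewrite {1}(svalP (ex n)).
by congr (diag_mx _ *m _); apply/rowP => i; rewrite mxE.
Qed.

Section Characters.
Variables (P : 'M[C]_N) (chi : 'I_N -> 'rV[int]_d -> C).
Hypothesis uP : P \in unitmx.
Hypothesis Pchi : forall n, P *m shift_mx n = diag_mx (\row_i chi i n) *m P.

Lemma diag_char n : diag_mx (\row_i chi i n) = P *m shift_mx n *m invmx P.
Proof. by rewrite Pchi mulmxK. Qed.

Lemma charE i n : chi i n = (P *m shift_mx n *m invmx P) i i.
Proof. by rewrite -diag_char !mxE eqxx mulr1n. Qed.

Lemma char0 i : chi i 0 = 1.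
Proof. by rewrite charE shift_mx0 mulmx1 mulmxV // mxE eqxx. Qed.

Lemma charD i m n : chi i (m + n) = chi i m * chi i n.
Proof.
rewrite charE shift_mxD mulmxA Pchi -(mulmxA _ P) Pchi mulmxA mulmxK // mul_diag_mx.
by rewrite !mxE eqxx mulr1n.
Qed.

Lemma char_lattice i a : lattice A a -> chi i a = 1.
Proof. by move=> ha; rewrite charE shift_lattice // mulmx1 mulmxV // mxE eqxx. Qed.

Lemma char_neq0 i n : chi i n != 0.
Proof.
have := charD i n (- n); rewrite subrr char0.
by apply: contra_eq_neq => ->; rewrite mul0r oner_eq0.
Qed.

Lemma charN i n : chi i (- n) = (chi i n)^-1.
Proof.
apply: (mulfI (char_neq0 i n)); rewrite -charD subrr char0 divff //.
exact: char_neq0.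
Qed.

Lemma charMn i n (k : nat) : chi i (n *+ k) = chi i n ^+ k.
Proof. by elim: k => [|k IH]; rewrite ?mulr0n ?char0 // mulrS exprS charD IH. Qed.

Lemma charMz i n (k : int) : chi i (n *~ k) = chi i n ^ k.
Proof. by case: k => k; rewrite ?NegzE ?mulrNz ?charN -?pmulrn charMn. Qed.

Lemma rv_basis n : n = \sum_k delta_mx 0 k *~ n 0 k.
Proof.
apply/rowP => k; rewrite summxE (bigD1 k) //= big1 => [|l lk].
  by rewrite -scaler_int !mxE !eqxx addr0; lia.
by rewrite -scaler_int !mxE [k == l]eq_sym (negPf lk) andbF mulr0.
Qed.

Lemma char_basis i n : chi i n = \prod_k chi i (delta_mx 0 k) ^ n 0 k.
Proof.
rewrite {1}(rv_basis n); apply: (big_rec2 (fun x y => chi i x = y)) => [|k x y _ <-].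
  exact: char0.
by rewrite charD charMz.
Qed.

Lemma char_inj i i' : chi i =1 chi i' -> i = i'.
Proof.
move=> e; apply/eqP; apply/negPn/negP => ii'.
have k0 : 'I_N := i.
have rowP' j l : P j k0 = chi j (rep l - rep k0) * P j l.
  have := congr1 (fun M : 'M[C]_N => M j l) (Pchi (rep l - rep k0)).
  rewrite mul_diag_mx !mxE (bigD1 k0) //= big1 => [|k kk0].
    rewrite mxE addr0; have -> : rep k0 + (rep l - rep k0) - rep l = 0 by vec.
    by rewrite asboolT ?mulr1 //; exact: lattice0.
  rewrite mxE; case: asboolP; rewrite ?mulr0 // => h.
  have /rep_eq kk : lattice A (rep k - rep k0).
    by have -> : rep k - rep k0 = rep k + (rep l - rep k0) - rep l by vec.
  by rewrite kk eqxx in kk0.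
have nz j : P j k0 != 0.
  apply/eqP => Pj0.
  have : (delta_mx 0 j : 'rV[C]_N) *m P = 0.
    rewrite -rowE; apply/rowP => l; rewrite !mxE.
    have := rowP' j l; rewrite Pj0 => /esym/eqP.
    by rewrite mulf_eq0 (negPf (char_neq0 _ _)) => /eqP.
  move=> /(congr1 (fun M => M *m invmx P)); rewrite mulmxK // mul0mx.
  by move=> /(congr1 (fun M : 'rV[C]_N => M 0 j)); rewrite !mxE !eqxx => /eqP; rewrite oner_eq0.
have : (P i' k0 *: delta_mx 0 i : 'rV[C]_N) *m P = (P i k0 *: delta_mx 0 i' : 'rV[C]_N) *m P.
  rewrite -!scalemxAl -!rowE; apply/rowP => l; rewrite !mxE.
  by rewrite (rowP' i' l) (rowP' i l) e; ring.
move=> /(can_inj (mulmxK uP)) /(congr1 (fun M : 'rV[C]_N => M 0 i)).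
rewrite !mxE !eqxx (negPf ii') mulr0 mulr1 => /eqP; exact/negP/nz.
Qed.

End Characters.
End Shift.

Lemma cis2pi_int (R : realType) (m : int) : cis2pi (m%:~R : R) = 1.
Proof.
have c1 : cis2pi (1 : R) = 1.
  by rewrite /cis2pi mulr1 mulr_natl cos2pi sin2pi.
have cn (n : nat) : cis2pi (n%:R : R) = 1.
  by elim: n => [|n IH]; rewrite ?cis2pi0 // -natr1 cis2piD IH c1 mulr1.
case: m => n; first exact: cn.
by rewrite NegzE mulrNz -conjc_cis2pi -pmulrn cn conjc1.
Qed.

Section Signs.
Variables (R : realType) (d : nat) (A : 'M[int]_d).
Hypothesis rkA : full_rank R A.
Notation N := (nbands R A).
Notation C := R[i].
Implicit Types (s : 'I_d -> int) (m n a : 'rV[int]_d) (i : 'I_N).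

Definition sdot s n : int := \sum_k s k * n 0 k.

(* No [s / p] with [2 <= p] is in the dual lattice. *)
Definition indivisible s : Prop :=
  forall p : nat, (2 <= p)%N -> exists2 a, lattice A a & ~~ (p %| sdot s a)%Z.

Definition is_sign s := forall k, s k = 1 \/ s k = -1.

Definition set_sign s (j : 'I_d) (x : int) := fun k => if k == j then x else s k.

Lemma not_divisible_signs : ~ divisible R (lattice A) ->
  exists j s, [/\ is_sign s, indivisible (set_sign s j 1) &
                  indivisible (set_sign s j (-1))].
Proof.
move=> ndiv; apply: contrapT => hno; apply: ndiv => e he j.
pose s k : int := if e 0 k == 1 then 1 else -1.
have ss : is_sign s by move=> k; rewrite /s; case: ifP; [left|right].
have se k : (s k)%:~R = e 0 k.
  rewrite /s; case: eqP => [->//|]; case: (he k) => -> //.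
pose es x : 'rV[R]_d := \row_k (set_sign s j x k)%:~R.
have dual x : ~ indivisible (set_sign s j x) ->
    exists2 p, (2 <= p)%N & dual_lattice (lattice A) (p%:R^-1 *: es x).
  move=> /existsNP[p] /not_implyP[p2 hp]; exists p => // a ha.
  have /negPn/dvdzP[q hq] : ~~ ~~ (p %| sdot (set_sign s j x) a)%Z.
    by apply/negP => h; apply: hp; exists a.
  have -> : dotv (p%:R^-1 *: es x) (intv a) = q%:~R; last exact: cis2pi_int.
  have p0 : p%:R != 0 :> R by rewrite pnatr_eq0; lia.
  apply: (mulfI p0); rewrite mulr_sumr.
  have -> : p%:R * q%:~R = (sdot (set_sign s j x) a)%:~R :> R.
    by rewrite hq intrM mulrC.
  rewrite /sdot rmorph_sum /=; apply: eq_bigr => k _.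
  by rewrite !mxE rmorphM /= mulrA mulrA divff // mul1r.
have esE x : x = 1 \/ x = -1 -> es x = e \/ es x = flip j e.
  move=> hx; have [sx|sx] := eqVneq x (s j); [left|right]; apply/rowP => k;
    rewrite !mxE /set_sign; case: eqP => [->|_] //; rewrite -se ?sx //.
  by rewrite -intrN; congr (_%:~R); case: (ss j) hx sx => -> [] ->.
have : ~ indivisible (set_sign s j 1) \/ ~ indivisible (set_sign s j (-1)).
  by apply/not_andP => -[h1 h2]; apply: hno; exists j, s; split.
case=> /dual[p p2 hp]; exists p => //.
  by have [] := esE 1 (or_introl erefl) => <-; [left|right].
by have [] := esE (-1) (or_intror erefl) => <-; [left|right].
Qed.

End Signs.

Section Separation.
Variables (R : realType) (d : nat) (A : 'M[int]_d).
Hypothesis rkA : full_rank R A.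
Notation N := (nbands R A).
Notation C := R[i].
Implicit Types (s : 'I_d -> int) (m n a : 'rV[int]_d) (i : 'I_N).
Variables (P : 'M[C]_N) (chi : 'I_N -> 'rV[int]_d -> C).
Hypothesis uP : P \in unitmx.
Hypothesis Pchi : forall n, P *m shift_mx R A n = diag_mx (\row_i chi i n) *m P.

Lemma root_of_unity_indivisible s (r : C) : indivisible A s -> r != 0 ->
  (forall a, lattice A a -> r ^ sdot s a = 1) -> r = 1.
Proof.
move=> inds r0 hr.
have ex : exists m : nat, (0 < m)%N && (r ^+ m == 1).
  have [a ha na] := inds 2%N isT; exists `|sdot s a|%N.
  rewrite absz_gt0; apply/andP; split.
    by apply: contraNneq na => ->; rewrite dvdz0.
  have := hr a ha; case: (sdot s a) => q; first by move=> /= <-.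
  by rewrite NegzE /= => /(congr1 GRing.inv); rewrite invr1 => <-; rewrite -exprnN invrK.
case: (ex_minnP ex) => m /andP[m0 /eqP rm] mmin.
have [m1|m1] := leqP m 1%N.
  by have m1' : m = 1%N by [apply/eqP; rewrite eqn_leq m1 m0]; rewrite -rm m1' expr1.
have [a ha /negP[]] := inds m m1.
have m0' : (m : int) != 0 by rewrite gt_eqF.
have : r ^ (sdot s a %% m)%Z = 1.
  have := hr a ha; rewrite {1}(divz_eq (sdot s a) m) expfzDr // mulrC -exprz_exp.
  by rewrite exprzAC -exprnP rm exp1rz mulr1.
have := modz_ge0 (sdot s a) m0'; have := ltz_mod (sdot s a) m0'.
rewrite (sameP dvdz_mod0P eqP).
case: (modz _ _) => // q ltq _ hq.
rewrite eqz_nat -leqn0 leqNgt; apply/negP => q0.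
have := mmin q; rewrite q0 /= exprnP hq eqxx => /(_ isT); rewrite leqNgt; case/negP; exact: ltq.
Qed.

Lemma char_sep s j i i' : is_sign s -> indivisible A s -> i != i' ->
  exists2 k, k != j & chi i (delta_mx 0 k *~ s k - delta_mx 0 j *~ s j) !=
                      chi i' (delta_mx 0 k *~ s k - delta_mx 0 j *~ s j).
Proof.
move=> ss inds ii'; apply: contrapT => hno; move/eqP: ii'; apply.
pose psi n := chi i n / chi i' n.
have psi0 n : psi n != 0 by rewrite mulf_neq0 ?invr_eq0 ?(char_neq0 rkA uP Pchi).
pose r := psi (delta_mx 0 j *~ s j).
have hk k : psi (delta_mx 0 k *~ s k) = r.
  have [->//|kj] := eqVneq k j.
  have : chi i (delta_mx 0 k *~ s k - delta_mx 0 j *~ s j) =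
         chi i' (delta_mx 0 k *~ s k - delta_mx 0 j *~ s j).
    by apply/eqP/negPn/negP => h; apply: hno; exists k.
  rewrite !(charD rkA uP Pchi) !(charN rkA uP Pchi) /r /psi => /eqP.
  rewrite eqr_div ?(char_neq0 rkA uP Pchi) // => /eqP h.
  by apply/eqP; rewrite eqr_div ?(char_neq0 rkA uP Pchi) //; rewrite h mulrC.
have hk1 k : psi (delta_mx 0 k) = r ^ s k.
  have e1 : psi (delta_mx 0 k *~ s k) = psi (delta_mx 0 k) ^ s k.
    by rewrite /psi !(charMz rkA uP Pchi) expfzMl expfV.
  rewrite -(hk k) e1 exprz_exp; by case: (ss k) => ->; rewrite ?mulrNN mulr1 expr1z.
have psiE n : psi n = r ^ sdot s n.
  rewrite /psi !(char_basis rkA uP Pchi _ n) -prodfV -big_split /=.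
  rewrite /sdot; apply: (big_rec2 (fun x y => x = r ^ y)) => [|k x y _ ->].
    by rewrite expr0z.
  rewrite expfzDr ?psi0 // -exprz_exp -hk1; congr (_ * _).
  by rewrite expfV -expfzMl.
have r1 : r = 1.
  apply: root_of_unity_indivisible inds (psi0 _) _ => a ha.
  by rewrite -psiE /psi !(char_lattice rkA uP Pchi) // divr1.
apply: (char_inj rkA uP Pchi) => n.
by have := psiE n; rewrite r1 exp1rz => /divr1_eq.
Qed.

End Separation.

Lemma generic_powers (F : numDomainType) d (I : finType) (u : I -> 'I_d -> F) :
  (forall a, exists k, u a k != 0) ->
  exists2 t : F, t != 0 & forall a, \sum_(k < d) t ^+ k * u a k != 0.
Proof.
move=> hu.
pose q a : {poly F} := \poly_(k < d) oapp (u a) 0 (insub k).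
have qE a t : (q a).[t] = \sum_(k < d) t ^+ k * u a k.
  rewrite horner_poly; apply: eq_bigr => k _.
  by rewrite valK /= mulrC.
pose p := 'X * \prod_a q a.
have p0 : p != 0.
  rewrite mulf_neq0 ?polyX_eq0 //; apply/prodf_neq0 => a _.
  have [k uk] := hu a; apply: contra_neq uk => /(congr1 (fun r : {poly F} => r`_k)).
  by rewrite coef_poly ltn_ord coef0 valK.
have [t pt] : exists t, ~~ root p t.
  pose rs : seq F := [seq i%:R | i <- iota 0 (size p)].
  have : ~~ all (root p) rs.
    apply/negP => /(max_poly_roots p0) /implyP.
    rewrite map_inj_uniq ?iota_uniq; last exact: mulrIn (oner_neq0 F).
    by rewrite size_map size_iota ltnn.
  by move=> /allPn[t _ tp]; exists t.
move: pt; rewrite rootM rootX negb_or => /andP[t0]; rewrite rootE horner_prod => /prodf_neq0 h.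
by exists t => // a; rewrite -qE h.
Qed.

Lemma det_eq0_diag (F : fieldType) n (P M : 'M[F]_n) (v : 'rV_n) i :
  P \in unitmx -> P *m M = diag_mx v *m P -> v 0 i = 0 -> \det M = 0.
Proof.
rewrite unitmxE unitfE => uP h v0; apply: (mulfI uP).
by rewrite mulr0 -det_mulmx h det_mulmx det_diag (bigD1 i) //= v0 !mul0r.
Qed.

Section Transfer.
Variables (R : realType) (d : nat) (A : 'M[int]_d).
Hypothesis rkA : full_rank R A.
Notation N := (nbands R A).
Notation C := R[i].
Implicit Types (s : 'I_d -> int) (z : 'I_d -> C) (i : 'I_N) (j : 'I_d).
Notation S := (shift_mx R A).
Notation e_ := (@delta_mx int 1 d 0).

Definition hop j z : 'M[C]_N :=
  \sum_(k | k != j) (z k *: S (e_ k) + (z k)^-1 *: S (- e_ k)).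

(* Its eigenvalues are the [x] with [det (x^2 + x S(-e_j) (hop j z + D) + S(-2 e_j)) = 0]. *)
Definition transfer j (D : 'M[C]_N) z : 'M[C]_(N + N) :=
  block_mx 0 1%:M (- S (- e_ j - e_ j)) (- (S (- e_ j) *m (hop j z + D))).

Lemma transfer_separable s j (D : 'M[C]_N) : is_sign s ->
  indivisible A (set_sign s j 1) -> indivisible A (set_sign s j (-1)) ->
  (2 <= d)%N ->
  exists2 z : 'I_d -> C, (forall k, z k != 0) &
    separable_poly (char_poly (transfer j D z)).
Proof.
move=> ss ind1 ind2 d2.
have [P uP [chi Pchi]] := joint_spectrum rkA.
pose sg (b : bool) : int := if b then 1 else -1.
pose c b i k := if k == j then 0 else chi i (e_ k *~ s k - e_ j *~ sg b).
have [k0 k0j] : exists k0, k0 != j.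
  have [->|h] := eqVneq j (Ordinal (ltnW d2)).
    by exists (Ordinal d2).
  by exists (Ordinal (ltnW d2)); rewrite eq_sym.
pose u (x : bool * ('I_N * 'I_N)) k :=
  if x.2.1 == x.2.2 then c x.1 x.2.1 k else c x.1 x.2.1 k - c x.1 x.2.2 k.
have [|t t0 ht] := @generic_powers C d _ u.
  move=> [b [i i']]; rewrite /u /=; case: eqP => [_|/eqP ii'].
    by exists k0; rewrite /c (negPf k0j) (char_neq0 rkA uP Pchi).
  have hs : is_sign (set_sign s j (sg b)).
    by move=> k; rewrite /set_sign /sg; case: eqP; case: b; auto.
  have hind : indivisible A (set_sign s j (sg b)) by case: b {hs}.
  have [k kj hk] := char_sep rkA uP Pchi j hs hind ii'.
  exists k; rewrite /c (negPf kj) subr_eq0.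
  by move: hk; rewrite /set_sign (negPf kj) eqxx.
pose lam b i := \sum_(k < d) t ^+ k * c b i k.
have lam0 b i : lam b i != 0.
  by have := ht (b, (i, i)); rewrite /u /= eqxx.
have laminj b : injective (lam b).
  move=> i i' e; apply/eqP; apply/negPn/negP => ii'.
  have := ht (b, (i, i')); rewrite /u /= (negPf ii').
  under eq_bigr do rewrite mulrBr.
  by rewrite sumrB -/(lam b i) -/(lam b i') e subrr eqxx.
pose P0 : 'M[C]_N := S (- e_ j) *m \sum_(k | k != j) t ^+ k *: S (e_ k *~ s k).
pose P2 : 'M[C]_N := S (- e_ j) *m \sum_(k | k != j) (t ^+ k)^-1 *: S (- (e_ k *~ s k)).
pose Q : 'M[C]_N := S (- e_ j - e_ j).
have PP0 : P *m P0 = diag_mx (\row_i lam true i) *m P.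
  rewrite /P0 !mulmx_sumr.
  have -> : diag_mx (\row_i lam true i) =
      \sum_(k | k != j) t ^+ k *: diag_mx (\row_i chi i (- e_ j + e_ k *~ s k)).
    apply/matrixP => i i'; rewrite summxE !mxE /lam (bigD1 j) //= /c eqxx mulr0 add0r.
    rewrite -sumrMnl; apply: eq_bigr => k kj.
    by rewrite (negPf kj) !mxE mulrnAr addrC /sg mulr1z.
  rewrite mulmx_suml; apply: eq_bigr => k _.
  by rewrite -scalemxAl -Pchi (shift_mxD rkA) -!scalemxAr.
have [|||||||t' t'0 sep] := @separable_pencil _ _ P0 (S (- e_ j) *m D) P2 Q
   (fun i => - lam true i) (fun i => - lam false i).
- exact: det_shift.
- by move=> i i' /oppr_inj /laminj.
- by move=> i; rewrite oppr_eq0.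
- move=> i; apply: (det_eq0_diag (i := i) (v := \row_i' (- lam true i + lam true i')) uP).
    rewrite mulmxDr PP0 scalar_mxC -mulmxDl; congr (_ *m _).
    by apply/matrixP => a b; rewrite !mxE mulrnDl.
  by rewrite mxE addNr.
- by move=> i i' /oppr_inj /laminj.
- by move=> i; rewrite oppr_eq0.
- move=> i; apply: (det_eq0_diag (i := i)
    (v := \row_i' (- lam false i * chi i' (- e_ j - e_ j) + lam true i')) uP).
    rewrite mulmxDr PP0 -scalemxAr Pchi scalemxAl -mulmxDl; congr (_ *m _).
    by apply/matrixP => a b; rewrite !mxE mulrnDl mulrnAr.
  rewrite mxE mulNr mulr_suml addrC; apply/eqP; rewrite subr_eq0; apply/eqP.
  apply: eq_bigr => k _; rewrite -mulrA; congr (_ * _); rewrite /c.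
  case: eqP => _; first by rewrite mul0r.
  by rewrite -(charD rkA uP Pchi); congr (chi i _); rewrite /sg mulrNz opprK mulr1z; vec.
exists (fun k : 'I_d => (t ^+ k / t') ^ s k).
  move=> k; rewrite expfz_neq0 // mulf_neq0 ?expf_neq0 // invr_eq0 gt_eqF //.
rewrite /transfer; move: sep; congr (is_true (separable_poly (char_poly (block_mx _ _ _ (- _))))).
rewrite mulmxDr addrAC; congr (_ + _).
rewrite /P0 /P2 !scalemxAr -mulmxDr; congr (_ *m _).
rewrite !scaler_sumr -big_split /=; apply: eq_bigr => k kj.
rewrite !scalerA; case: (ss k) => ->.
  by rewrite expr1z mulr1z invf_div [t' / _]mulrC; congr (_ *: _ + _ *: _); rewrite mulrC.
rewrite exprN1 invrK mulrN1z opprK addrC invf_div.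
by congr (_ *: _ + _ *: _); rewrite mulrC.
Qed.

End Transfer.

(** * Trigonometric polynomials *)

Section Bounds.
Variable R : realType.
Implicit Types (t u : R) (z w : R[i]).

Lemma mvt_bound (f df : R -> R) u (B : R) : (forall x : R, is_derive x 1 f (df x)) ->
  (forall x, `|x| <= `|u| -> `|df x| <= B) -> `|f u - f 0| <= B * `|u|.
Proof.
move=> hf hB.
have cf a b : {within `[a, b], continuous f}.
  apply: continuous_subspaceT => x; apply: differentiable_continuous.
  by apply/derivable1_diffP; exact: ex_derive.
have [u0|u0] := leP 0 u.
  have [c /itvP hc ->] := @MVT_segment R f df 0 u u0 (fun x _ => hf x) (cf _ _).
  by rewrite subr0 normrM ler_wpM2r // hB // ?ger0_norm ?hc.
rewrite distrC.
have [c /itvP hc ->] := @MVT_segment R f df u 0 (ltW u0) (fun x _ => hf x) (cf _ _).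
rewrite sub0r normrM normrN ler_wpM2r // hB //.
by rewrite (ltr0_norm u0) ler0_norm ?lerN2 ?hc.
Qed.

Lemma norm_sin_le u : `|sin u| <= `|u|.
Proof.
have := @mvt_bound sin cos u 1 (fun x => is_derive_sin x).
by rewrite sin0 subr0 mul1r; apply => x _; exact: cos_max.
Qed.

Lemma norm_cos_sub1_le u : `|cos u - 1| <= `|u|.
Proof.
have := @mvt_bound cos (fun x => - sin x) u 1 (fun x => is_derive_cos x).
by rewrite cos0 mul1r; apply => x _; rewrite normrN sin_max.
Qed.

Lemma norm_cos_sub1_le_sqr u : `|cos u - 1| <= u ^+ 2.
Proof.
have := @mvt_bound cos (fun x => - sin x) u `|u| (fun x => is_derive_cos x).
rewrite cos0 -expr2 real_normK ?num_real //; apply => x xu.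
by rewrite normrN (le_trans (norm_sin_le x)).
Qed.

Lemma norm_sin_sub_le_sqr u : `|sin u - u| <= u ^+ 2.
Proof.
have := @mvt_bound (fun x => sin x - x) (fun x => cos x - 1) u `|u|.
rewrite sin0 subr0 subr0 -expr2 real_normK ?num_real //; apply => x xu.
by rewrite (le_trans (norm_cos_sub1_le x)).
Qed.

Lemma normc_le z : normc z <= `|complex.Re z| + `|complex.Im z|.
Proof.
case: z => a b /=; rewrite -[leRHS]ger0_norm ?addr_ge0 // -sqrtr_sqr.
apply: ler_wsqrtr; rewrite sqrrD -(real_normK (num_real a)) -(real_normK (num_real b)).
by rewrite lerD2r lerDl mulrn_wge0 // mulr_ge0.
Qed.

Lemma normc_ge0 z : 0 <= normc z.
Proof. by case: z => a b; exact: sqrtr_ge0. Qed.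

Lemma le_normc_sum (I : Type) (s : seq I) (F : I -> R[i]) :
  normc (\sum_(i <- s) F i) <= \sum_(i <- s) normc (F i).
Proof.
elim: s => [|i s IH]; first by rewrite !big_nil normc0.
by rewrite !big_cons (le_trans (le_normcD _ _)) // lerD2l.
Qed.

Lemma normc_real t : normc (real_complex R t) = `|t|.
Proof. by rewrite /= expr0n addr0 sqrtr_sqr. Qed.

Lemma normc_cis2pi t : normc (cis2pi t) = 1.
Proof. by rewrite /= cos2Dsin2 sqrtr1. Qed.

Lemma normc_opp z : normc (- z) = normc z.
Proof. by case: z => a b /=; rewrite !sqrrN. Qed.

Lemma normc_lowerB z w : normc z - normc w <= normc (z - w).
Proof. by rewrite lerBlDr -{1}(subrK w z) le_normcD. Qed.

Lemma cis2pi_lip t : normc (cis2pi t - 1) <= 2 * `|2 * pi * t|.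
Proof.
apply: le_trans (normc_le _) _; rewrite /= subr0 [leRHS]mulr_natl mulr2n.
by apply: lerD; [exact: norm_cos_sub1_le|exact: norm_sin_le].
Qed.

Definition tau_i t : R[i] := Complex 0 (2 * pi * t).

Lemma cis2pi_taylor t :
  normc (cis2pi t - 1 - tau_i t) <= 2 * (2 * pi * t) ^+ 2.
Proof.
apply: le_trans (normc_le _) _; rewrite /= !subr0 [leRHS]mulr_natl mulr2n.
by apply: lerD; [exact: norm_cos_sub1_le_sqr|exact: norm_sin_sub_le_sqr].
Qed.

End Bounds.

Lemma interpolation (F : fieldType) (W : seq F) (g : F -> F) : uniq W ->
  exists q : {poly F}, forall w, w \in W -> q.[w] = g w.
Proof.
elim: W => [|w W IH] /=; first by exists 0.
move=> /andP[wW /IH[q hq]].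
pose r := \prod_(x <- W) ('X - x%:P).
have r0 : r.[w] != 0 by rewrite -rootE root_prod_XsubC.
exists (q + ((g w - q.[w]) / r.[w]) *: r) => x; rewrite inE !hornerE.
case: eqP => [->|_] /= xW; first by rewrite divfK // addrC subrK.
by have /rootP -> : root r x; rewrite ?root_prod_XsubC // mulr0 addr0 hq.
Qed.

Section TrigPoly.
Variables (R : realType) (d : nat).
Notation C := R[i].
Implicit Types (s : seq (C * 'rV[int]_d)) (th v h : 'rV[R]_d) (n : 'rV[int]_d).
Implicit Types (z : 'I_d -> C).

Definition leval s z : C := \sum_(t <- s) t.1 * \prod_k z k ^ t.2 0 k.

Definition trig s th : C := \sum_(t <- s) t.1 * cis2pi (dotv th (intv t.2)).

Definition torus th : 'I_d -> C := fun k => cis2pi (th 0 k).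

Definition dfreq v n : C := tau_i (dotv v (intv n)).

Definition dtrig v s := [seq (t.1 * dfreq v t.2, t.2) | t <- s].

Definition vnorm v : R := \sum_k `|v 0 k|.

Lemma cis2pi_neq0 (t : R) : cis2pi t != 0.
Proof.
apply/eqP => /(congr1 (@normc R)); rewrite normc_cis2pi normc0 => /eqP.
by rewrite oner_eq0.
Qed.

Lemma cis2piN (t : R) : cis2pi (- t) = (cis2pi t)^-1.
Proof.
apply: (mulfI (cis2pi_neq0 t)).
by rewrite -cis2piD subrr cis2pi0 divff // cis2pi_neq0.
Qed.

Lemma cis2pi_exp (t : R) (m : int) : cis2pi t ^ m = cis2pi (t * m%:~R).
Proof.
have h (n : nat) : cis2pi t ^+ n = cis2pi (t * n%:R).
  elim: n => [|n IH]; first by rewrite expr0 mulr0 cis2pi0.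
  by rewrite exprS IH -cis2piD -natr1 mulrDr mulr1 addrC.
case: m => n; first exact: h.
by rewrite NegzE -exprnN h -cis2piN mulrNz mulrN.
Qed.

Lemma trigE s th : trig s th = leval s (torus th).
Proof.
apply: eq_bigr => t _; congr (_ * _).
rewrite /dotv (big_morph (@cis2pi R) (@cis2piD R) (@cis2pi0 R)).
by apply: eq_bigr => k _; rewrite cis2pi_exp mxE.
Qed.

Lemma dotvDl (x y u : 'rV[R]_d) : dotv (x + y) u = dotv x u + dotv y u.
Proof. by rewrite -big_split; apply: eq_bigr => k _; rewrite mxE mulrDl. Qed.

Lemma dotvZl (c : R) (x u : 'rV[R]_d) : dotv (c *: x) u = c * dotv x u.
Proof. by rewrite mulr_sumr; apply: eq_bigr => k _; rewrite mxE mulrA. Qed.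

Lemma norm_dotv_le v n : `|dotv v (intv n)| <= vnorm v * vnorm (intv n).
Proof.
rewrite (le_trans (ler_norm_sum _ _ _)) // mulr_suml ler_sum // => k _.
rewrite normrM ler_wpM2l // /vnorm (bigD1 k) //= lerDl.
exact: sumr_ge0.
Qed.

Lemma vnorm_ge0 v : 0 <= vnorm v. Proof. exact: sumr_ge0. Qed.

Lemma trig_lip s : exists2 L, 0 < L &
  forall th h, normc (trig s (th + h) - trig s th) <= L * vnorm h.
Proof.
exists (1 + \sum_(t <- s) normc t.1 * (4 * pi * vnorm (intv t.2 : 'rV[R]_d))).
  rewrite ltr_pwDl // sumr_ge0 // => t _.
  by rewrite !mulr_ge0 ?normc_ge0 ?pi_ge0 ?vnorm_ge0.
move=> th h; rewrite -sumrB (le_trans (le_normc_sum _ _)) //.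
rewrite mulrDl mul1r -[leLHS]add0r lerD ?vnorm_ge0 // mulr_suml ler_sum // => t _.
rewrite dotvDl cis2piD -mulrBr normcM -[leRHS]mulrA ler_wpM2l ?normc_ge0 //.
rewrite -{2}[cis2pi _]mulr1 -mulrBr normcM normc_cis2pi mul1r.
apply: le_trans (cis2pi_lip _) _; rewrite normrM ger0_norm ?mulr_ge0 ?pi_ge0 //.
rewrite mulrA; have -> : 2 * (2 * pi) = 4 * pi :> R by ring.
rewrite -[leRHS]mulrA ler_wpM2l ?mulr_ge0 ?pi_ge0 // [leRHS]mulrC; exact: norm_dotv_le.
Qed.

Lemma trig_taylor v s : exists2 M, 0 < M & forall th (x : R),
  normc (trig s (th + x *: v) - trig s th - real_complex R x * trig (dtrig v s) th)
    <= M * x ^+ 2.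
Proof.
exists (1 + \sum_(t <- s) normc t.1 * (2 * (2 * pi * dotv v (intv t.2)) ^+ 2)).
  rewrite ltr_pwDl // sumr_ge0 // => t _.
  by rewrite mulr_ge0 ?normc_ge0 // mulr_ge0 ?sqr_ge0.
move=> th x; rewrite /trig big_map mulr_sumr -!sumrB (le_trans (le_normc_sum _ _)) //.
rewrite mulrDl mul1r -[leLHS]add0r lerD ?sqr_ge0 // mulr_suml ler_sum // => t _ /=.
rewrite dotvDl cis2piD dotvZl.
set a := dotv v _; set e := cis2pi (dotv th _).
have -> : t.1 * (e * cis2pi (x * a)) - t.1 * e
    - real_complex R x * (t.1 * dfreq v t.2 * e)
  = t.1 * (e * (cis2pi (x * a) - 1 - tau_i (x * a))).
  have -> : tau_i (x * a) = real_complex R x * dfreq v t.2.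
    by apply/eqP; rewrite eq_complex /= !mul0r !mulr0 subr0 addr0 eqxx /=; apply/eqP; rewrite /a; ring.
  ring.
rewrite !normcM normc_cis2pi mul1r -[leRHS]mulrA ler_wpM2l ?normc_ge0 //.
apply: le_trans (cis2pi_taylor _) _.
by rewrite le_eqVlt; apply/orP; left; apply/eqP; ring.
Qed.

Lemma trig_iter v s m th : trig (iter m (dtrig v) s) th =
  \sum_(t <- s) t.1 * dfreq v t.2 ^+ m * cis2pi (dotv th (intv t.2)).
Proof.
elim: m s => [|m IH] s.
  by apply: eq_bigr => t _; rewrite expr0 mulr1.
rewrite iterSr IH big_map; apply: eq_bigr => t _ /=.
by rewrite exprS !mulrA.
Qed.

Lemma trig_separate v s th (g : 'rV[int]_d -> C) :
  (forall m, trig (iter m (dtrig v) s) th = 0) ->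
  {in s &, forall t t', dfreq v t.2 = dfreq v t'.2 -> g t.2 = g t'.2} ->
  \sum_(t <- s) t.1 * g t.2 * cis2pi (dotv th (intv t.2)) = 0.
Proof.
move=> h0 hg; pose ws := [seq dfreq v t.2 | t <- s].
pose gg w := g (nth (0, 0) s (index w ws)).2.
have [q hq] := interpolation gg (undup_uniq ws).
transitivity (\sum_(t <- s) t.1 * q.[dfreq v t.2] * cis2pi (dotv th (intv t.2))).
  rewrite big_seq [RHS]big_seq; apply: eq_bigr => t ts; congr (_ * _ * _).
  have tw : dfreq v t.2 \in ws by apply: (map_f (fun t => dfreq v t.2)).
  rewrite hq ?mem_undup // /gg; apply: hg => //.
    by rewrite mem_nth // -(size_map (fun t => dfreq v t.2) s) index_mem.
  rewrite -(nth_map _ 0 (fun t => dfreq v t.2)) ?nth_index //.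
  by rewrite -(size_map (fun t => dfreq v t.2) s) index_mem.
under eq_bigr => t _.
  rewrite horner_coef mulr_sumr mulr_suml; over.
rewrite exchange_big /= big1 // => m _.
transitivity (q`_m * trig (iter m (dtrig v) s) th); last by rewrite h0 mulr0.
by rewrite trig_iter mulr_sumr; apply: eq_bigr => t _; ring.
Qed.

Lemma trig_line_nonzero v s th (x : R) : trig s (th + x *: v) != 0 ->
  exists m, trig (iter m (dtrig v) s) th != 0.
Proof.
move=> nz; apply: contrapT => hno; move/eqP: nz; apply.
have h0 m : trig (iter m (dtrig v) s) th = 0.
  by apply/eqP/negPn/negP => h; apply: hno; exists m.
rewrite -[RHS](trig_separate (g := fun n => cis2pi (x * dotv v (intv n))) h0).
  apply: eq_bigr => t _; rewrite dotvDl dotvZl cis2piD; ring.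
move=> t t' _ _ [] /(mulfI _) -> //.
by rewrite mulf_neq0 // ?pnatr_eq0 // gt_eqF // pi_gt0.
Qed.

Lemma trig_generic s z : leval s z != 0 -> (forall k, z k != 0) ->
  exists2 v : 'rV[R]_d, (forall k, v 0 k != 0) &
    forall th, exists m, trig (iter m (dtrig v) s) th != 0.
Proof.
move=> nz z0.
pose m := size s.
pose u (x : 'I_m * 'I_m) (k : 'I_d) : R :=
  let n := (nth (0, 0) s x.1).2 - (nth (0, 0) s x.2).2 in
  if n == 0 then 1 else (n 0 k)%:~R.
have [d0|dpos] := posnP d.
  have d0' (k : 'I_d) : False by case: k => k; rewrite d0.
  exists 0 => [k|th]; first by case: (d0' k).
  exists 0%N; apply: contra_neq nz => /= <-.
  by rewrite trigE; congr leval; apply/funext => k; case: (d0' k).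
have [|c c0 hc] := @generic_powers R d _ u.
  move=> x; rewrite /u; case: eqP => [_|/eqP n0].
    by exists (Ordinal dpos); exact: oner_neq0.
  have [k nk] : exists k, ((nth (0, 0) s x.1).2 - (nth (0, 0) s x.2).2) 0 k != 0.
    apply: contrapT => hno; move/eqP: n0; apply; apply/rowP => k; rewrite [RHS]mxE.
    by apply/eqP/negPn/negP => h; apply: hno; exists k.
  by exists k; rewrite intr_eq0.
exists (\row_k c ^+ k) => [k|th]; first by rewrite mxE expf_neq0.
apply: contrapT => hno; move/eqP: nz; apply.
have h0 l : trig (iter l (dtrig (\row_k c ^+ k)) s) th = 0.
  by apply/eqP/negPn/negP => h; apply: hno; exists l.
rewrite -[RHS](trig_separate (g := fun n => \prod_k z k ^ n 0 k
   / cis2pi (dotv th (intv n))) h0).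
  by apply: eq_bigr => t _; rewrite mulrA mulfVK // cis2pi_neq0.
move=> t t' ts ts' [] /(mulfI _); rewrite mulf_neq0 ?pnatr_eq0 // ?gt_eqF ?pi_gt0 //.
move=> /(_ isT) e; suff -> : t.2 = t'.2 by [].
apply/eqP; apply/negPn/negP; rewrite -subr_eq0 => tt'.
have it : (index t s < m)%N by rewrite index_mem.
have it' : (index t' s < m)%N by rewrite index_mem.
have /eqP := hc (Ordinal it, Ordinal it').
rewrite /u /= !nth_index // (negPf tt'); apply.
move/eqP: e; rewrite -subr_eq0 -sumrB => /eqP e; rewrite -[RHS]e.
by apply: eq_bigr => k _; rewrite !mxE -mulrBr -intrB.
Qed.

End TrigPoly.

(** * Laurent polynomials and the discriminant *)

(* [map_resultant] covers only morphisms defined on a polynomial ring. *)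
Lemma rmorph_resultant (K L : nzRingType) (f : {rmorphism K -> L}) (p q : {poly K}) :
  f (lead_coef p) != 0 -> f (lead_coef q) != 0 ->
  f (resultant p q) = resultant (map_poly f p) (map_poly f q).
Proof.
move=> fp fq; rewrite /resultant /Sylvester_mx !size_map_poly_id0 //.
rewrite -det_map_mx map_col_mx; congr (\det (col_mx _ _));
  by apply: map_lin1_mx => v; rewrite map_poly_rV rmorphM /= map_rVpoly.
Qed.

Section Closed.
Variables (K : comNzRingType) (S : subringClosed K).

Lemma rpred_det n (M : 'M[K]_n) : (forall i k, M i k \in S) -> \det M \in S.
Proof.
by move=> h; apply: rpred_sum => s _; rewrite rpredMsign rpred_prod.
Qed.

Lemma polyOver_char_poly n (M : 'M[K]_n) : (forall i k, M i k \in S) ->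
  char_poly M \is a polyOver S.
Proof.
move=> h; apply: rpred_sum => s _; rewrite rpredMsign rpred_prod // => i _.
by rewrite !mxE rpredB ?rpredMn ?polyOverX ?polyOverC.
Qed.

Lemma rpred_resultant (p q : {poly K}) :
  p \is a polyOver S -> q \is a polyOver S -> resultant p q \in S.
Proof.
move=> /polyOverP hp /polyOverP hq; apply: rpred_det => i k.
rewrite /Sylvester_mx !mxE; case: fintype.split => a; rewrite !mxE /= rVpoly_delta coefXnM;
  by case: ifP => _; rewrite ?rpred0.
Qed.

End Closed.

Section Laurent.
Variables (R : realType) (d : nat).
Notation C := R[i].
Notation X := ('I_d -> C).
Notation K := (X -> C).
Implicit Types (f g : K) (z : X).

HB.instance Definition _ := isPointed.Build R[i] 0.

Definition laurent f := exists s, forall z, (forall k, z k != 0) -> f z = leval s z.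

Lemma laurent_cst (c : C) : laurent (fun=> c).
Proof.
exists [:: (c, 0)] => z _; rewrite /leval big_seq1 /= big1 ?mulr1 // => k _.
by rewrite mxE expr0z.
Qed.

Lemma laurentB f g : laurent f -> laurent g -> laurent (fun z => f z - g z).
Proof.
move=> [s hs] [r hr]; exists (s ++ [seq (- t.1, t.2) | t <- r]) => z z0.
rewrite hs // hr // /leval big_cat /= big_map -sumrN; congr (_ + _).
by apply: eq_bigr => t _ /=; rewrite mulNr.
Qed.

Lemma laurentM f g : laurent f -> laurent g -> laurent (fun z => f z * g z).
Proof.
move=> [s hs] [r hr].
exists [seq (t.1 * u.1, t.2 + u.2) | t <- s, u <- r] => z z0.
rewrite hs // hr // /leval big_allpairs_dep /= mulr_suml; apply: eq_bigr => t _.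
rewrite mulr_sumr; apply: eq_bigr => u _; rewrite mulrACA -big_split /=.
congr (_ * _); apply: eq_bigr => k _; by rewrite mxE expfzDr.
Qed.

Lemma laurent_coord (j : 'I_d) : laurent (fun z => z j).
Proof.
exists [:: (1, delta_mx 0 j)] => z z0; rewrite /leval big_seq1 mul1r (bigD1 j) //=.
rewrite big1 ?mulr1 => [|k kj]; first by rewrite mxE !eqxx expr1z.
by rewrite mxE (negPf kj) andbF expr0z.
Qed.

Lemma laurent_coordV (j : 'I_d) : laurent (fun z => (z j)^-1).
Proof.
exists [:: (1, - delta_mx 0 j)] => z z0; rewrite /leval big_seq1 mul1r (bigD1 j) //=.
rewrite big1 ?mulr1 => [|k kj]; first by rewrite !mxE !eqxx exprN1.
by rewrite !mxE (negPf kj) andbF oppr0 expr0z.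
Qed.

Definition laurent_pred : {pred K} := [pred f | `[< laurent f >]].

Lemma laurent_subring : subring_closed laurent_pred.
Proof.
split=> [|f g|f g]; rewrite !inE.
- exact: (laurent_cst (1 : C)).
- by move=> hf hg; exact: laurentB.
- by move=> hf hg; exact: laurentM.
Qed.
HB.instance Definition _ := GRing.isSubringClosed.Build K laurent_pred laurent_subring.

Definition evalat z f : C := f z.
Lemma evalat_zmod z : zmod_morphism (evalat z). Proof. by []. Qed.
Lemma evalat_monoid z : monoid_morphism (evalat z). Proof. by []. Qed.
HB.instance Definition _ z := GRing.isZmodMorphism.Build K C (evalat z) (evalat_zmod z).
HB.instance Definition _ z := GRing.isMonoidMorphism.Build K C (evalat z) (evalat_monoid z).

Lemma laurent_sum (I : finType) (P : pred I) (f : I -> K) :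
  (forall i, laurent (f i)) -> laurent (fun z => \sum_(i | P i) f i z).
Proof.
move=> h; have : \sum_(i | P i) f i \in laurent_pred.
  by apply: rpred_sum => i _; apply/asboolP.
move=> /asboolP [s hs]; exists s => z /hs <-.
by rewrite -[RHS]/(evalat z _) rmorph_sum.
Qed.

Lemma laurentD f g : laurent f -> laurent g -> laurent (fun z => f z + g z).
Proof.
move=> /asboolP hf /asboolP hg; have : f + g \in laurent_pred by exact: rpredD.
by move=> /asboolP.
Qed.

Definition fun_mx m n (M : X -> 'M[C]_(m, n)) : 'M[K]_(m, n) :=
  \matrix_(i, k) (fun z => M z i k).

Lemma map_fun_mx m n (M : X -> 'M[C]_(m, n)) z : map_mx (evalat z) (fun_mx M) = M z.
Proof. by apply/matrixP => i k; rewrite !mxE. Qed.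

Lemma laurent_det n (M : X -> 'M[C]_n) :
  (forall i k, laurent (fun z => M z i k)) -> laurent (fun z => \det (M z)).
Proof.
move=> h; have : \det (fun_mx M) \in laurent_pred.
  by apply: rpred_det => i k; rewrite mxE; apply/asboolP.
move=> /asboolP [s hs]; exists s => z /hs <-.
by rewrite -[X in \det X]map_fun_mx det_map_mx.
Qed.

Lemma laurent_discriminant n (M : X -> 'M[C]_n) : (0 < n)%N ->
  (forall i k, laurent (fun z => M z i k)) ->
  laurent (fun z => resultant (char_poly (M z)) (char_poly (M z))^`()).
Proof.
move=> n0 h; pose p := char_poly (fun_mx M).
have hp : p \is a polyOver laurent_pred.
  by apply: polyOver_char_poly => i k; rewrite mxE; apply/asboolP.
have : resultant p p^`() \in laurent_pred.
  by apply: rpred_resultant => //; exact: polyOver_deriv.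
move=> /asboolP [s hs]; exists s => z /hs <-.
have sp : size p = n.+1 by exact: size_char_poly.
have lp : lead_coef p = 1 by apply/eqP; exact: char_poly_monic.
have np : (n%:R : C) != 0 by rewrite pnatr_eq0 -lt0n.
have cn : p^`()`_n.-1 = n%:R.
  have pn : p`_n = 1 by rewrite -lp lead_coefE sp.
  by rewrite coef_deriv prednK // pn.
have nK : (n%:R : K) != 0.
  apply: contra_neq np => /(congr1 (evalat z)).
  by rewrite rmorph_nat rmorph0.
have sp' : size p^`() = n.
  apply/eqP; rewrite eqn_leq -ltnS -sp lt_size_deriv -?size_poly_eq0 ?sp //=.
  rewrite leqNgt; apply/negP => lt.
  by move: nK; rewrite -cn nth_default ?eqxx // -ltnS prednK.
have lp' : lead_coef p^`() = n%:R by rewrite lead_coefE sp' cn.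
rewrite -[RHS]/(evalat z _) rmorph_resultant ?lp ?lp' ?rmorph1 ?rmorph_nat ?oner_eq0 //.
by rewrite -deriv_map map_char_poly map_fun_mx.
Qed.

End Laurent.

Arguments laurent_cst {R d} c.

(** * The Floquet matrix as a transfer pencil *)

Lemma l1norm_basis d (k : 'I_d) : l1norm (delta_mx 0 k : 'rV[int]_d) = 1.
Proof.
rewrite /l1norm (bigD1 k) //= big1 => [|l lk].
  by rewrite mxE !eqxx addr0.
by rewrite mxE (negPf lk) andbF normr0.
Qed.

Lemma l1norm_eq1 d (m : 'rV[int]_d) : l1norm m = 1 ->
  exists k (b : bool), m = if b then delta_mx 0 k else - delta_mx 0 k.
Proof.
move=> m1.
have [k mk] : exists k, m 0 k != 0.
  apply: contrapT => hno; move: m1; rewrite /l1norm big1 // => k _.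
  by apply/eqP; rewrite normr_eq0; apply/negPn/negP => h; apply: hno; exists k.
have h : `|m 0 k| + \sum_(l | l != k) `|m 0 l| = 1.
  by rewrite -m1 [RHS](bigD1 k).
have k1 : 1 <= `|m 0 k| by lia.
have s0 : 0 <= \sum_(l | l != k) `|m 0 l| by apply: sumr_ge0.
have s00 : \sum_(l | l != k) `|m 0 l| = 0 by lia.
have off l : l != k -> m 0 l = 0.
  move=> lk; apply/eqP; rewrite -normr_eq0.
  by move/eqP: s00; rewrite psumr_eq0 // => /allP/(_ l (mem_index_enum _))/implyP; apply.
exists k; have [mp|mn] : m 0 k = 1 \/ m 0 k = -1 by lia.
  exists true; apply/rowP => l; rewrite mxE eqxx /=; case: eqVneq => [->|/off ->] //.
exists false; apply/rowP => l; rewrite !mxE eqxx /=; case: eqVneq => [->|/off ->] //.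
Qed.

Lemma nbhd_sum d (W : nmodType) (f : 'rV[int]_d -> W) n :
  \sum_(m \in [set m | l1norm (m - n) = 1]) f m =
  \sum_k (f (n + delta_mx 0 k) + f (n - delta_mx 0 k)).
Proof.
pose h (x : 'I_d * bool) : 'rV[int]_d :=
  n + if x.2 then delta_mx 0 x.1 else - delta_mx 0 x.1.
rewrite (@reindex_fsbig _ _ _ _ _ h [set` enum {: 'I_d * bool}]).
  rewrite -fsbig_seq ?enum_uniq // big_enum /=.
  transitivity (\sum_k \sum_b f (h (k, b))).
    by rewrite pair_bigA; apply: eq_bigr => -[].
  by apply: eq_bigr => k _; rewrite big_bool.
split=> [x _|x y _ _|m hm].
- rewrite /h /= addrAC subrr add0r; case: x.2; rewrite ?l1normN l1norm_basis //.
- case: x y => [k b] [k' b'] /addrI /= e.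
  have := congr1 (fun r : 'rV[int]_d => r 0 k) e.
  have := congr1 (fun r : 'rV[int]_d => r 0 k') e.
  case: b b' {e} => -[]; rewrite !mxE !eqxx /= [k' == k]eq_sym; case: eqP => [-> //|_] //=.
- have [k [b e]] := l1norm_eq1 hm; exists (k, b); first by rewrite /= mem_enum.
  by rewrite /h /= -e addrC subrK.
Qed.

Section Floquet.
Variables (R : realType) (d : nat) (A : 'M[int]_d).
Hypothesis rkA : full_rank R A.
Notation N := (nbands R A).
Notation C := R[i].
Implicit Types (z : 'I_d -> C) (i : 'I_N) (j k : 'I_d) (D : 'M[C]_N).
Notation S := (shift_mx R A).
Notation e_ := (@delta_mx int 1 d 0).

Definition bulk z : 'M[C]_N := \sum_k (z k *: S (e_ k) + (z k)^-1 *: S (- e_ k)).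

Definition potential_mx V : 'M[C]_N := diag_mx (\row_i real_complex R (V (rep i))).

Lemma torus_neq0 (th : 'rV[R]_d) k : torus th k != 0.
Proof. exact: cis2pi_neq0. Qed.

Lemma dotv_basis (th : 'rV[R]_d) k : dotv th (intv (e_ k)) = th 0 k.
Proof.
rewrite /dotv (bigD1 k) //= big1 => [|l lk]; first by rewrite !mxE !eqxx mulr1 addr0.
by rewrite !mxE (negPf lk) andbF mulr0.
Qed.

Lemma det_floquet V (th : 'rV[R]_d) (x : C) :
  \det (floquet_mx A V th - x%:M) =
  \det (bulk (torus th) + potential_mx V - x%:M).
Proof.
pose g : 'rV[C]_N := \row_i cis2pi (dotv th (intv (rep i))).
have g0 i : g 0 i != 0 by rewrite mxE cis2pi_neq0.
have blochE i (k : 'I_N) n : bloch A th (rep k) (rep i + n) =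
    S n i k * (cis2pi (dotv th (intv n)) * g 0 i / g 0 k).
  rewrite /bloch !mxE; case: asboolP => _; last by rewrite mul0r.
  rewrite mul1r -cis2piN -!cis2piD -dotvNr -!dotvDr -intvN -!intvD.
  by congr (cis2pi (dotv _ (intv _))); vec.
have h : diag_mx g *m (bulk (torus th) + potential_mx V) = floquet_mx A V th *m diag_mx g.
  rewrite mul_diag_mx mul_mx_diag; apply/matrixP => i k; rewrite !mxE.
  rewrite /schrodinger nbhd_sum mulrDl mulrDr; congr (_ + _).
    rewrite summxE mulr_sumr mulr_suml; apply: eq_bigr => l _.
    rewrite !blochE intvN dotvNr dotv_basis cis2piN !mxE.
    rewrite /torus; move: (g0 k) (g0 i); rewrite !mxE => gk gi.
    by field; rewrite gk cis2pi_neq0.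
  rewrite bloch_rep //; case: eqVneq => [->|_]; first by rewrite mulr1n mulr1 mulrC.
  by rewrite !(mulr0n, mulr0, mul0r).
have dg : \det (diag_mx g) != 0.
  by rewrite det_diag; apply/prodf_neq0 => i _.
apply: (mulfI dg); rewrite [LHS]mulrC -!det_mulmx mulmxBr mulmxBl h.
by rewrite scalar_mxC.
Qed.

Lemma transfer_root j D z : z j != 0 ->
  (char_poly (transfer j D z)).[z j] =
  z j ^+ N * \det (S (- e_ j)) * \det (bulk z + D).
Proof.
move=> zj; rewrite horner_char_poly det_pencil -detZ -det_mulmx; congr determinant.
rewrite /bulk (bigD1 j) //= -/(hop A j z) -scalemxAl -[in RHS]addrA [in RHS]mulmxDr scalerDr.
rewrite [in RHS]mulmxDr -!scalemxAr -!(shift_mxD rkA) addNr (shift_mx0 rkA).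
rewrite scalerDr !scalerA divff // scale1r -expr2 scalemx1.
by rewrite -!addrA; congr (_ + _); rewrite addrC.
Qed.

Lemma laurent_shift_entry (f : ('I_d -> C) -> C) n i i' :
  laurent f -> laurent (fun z => (f z *: S n) i i').
Proof.
move=> hf; under eq_fun do rewrite mxE.
exact: laurentM hf (laurent_cst _).
Qed.

Lemma laurent_bulk D i i' : laurent (fun z => (bulk z + D) i i').
Proof.
under eq_fun do rewrite mxE summxE.
apply: laurentD; last exact: laurent_cst.
apply: laurent_sum => k; under eq_fun do rewrite mxE.
by apply: laurentD; apply: laurent_shift_entry;
  [exact: laurent_coord | exact: laurent_coordV].
Qed.

Lemma laurent_transfer j D (a b : 'I_(N + N)) :
  laurent (fun z => transfer j D z a b).
Proof.
have hhop i i' : laurent (fun z => (hop A j z + D) i i').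
  under eq_fun do rewrite mxE summxE.
  apply: laurentD; last exact: laurent_cst.
  apply: laurent_sum => k; under eq_fun do rewrite mxE.
  by apply: laurentD; apply: laurent_shift_entry;
    [exact: laurent_coord | exact: laurent_coordV].
have hmul (M : 'M[C]_N) i i' : laurent (fun z => (- (M *m (hop A j z + D))) i i').
  under eq_fun => z.
    rewrite mxE mxE -sumrN.
    under eq_bigr do rewrite -mulNr; over.
  apply: laurent_sum => k.
  exact: (laurentM (f := fun=> - M i k) (laurent_cst _)).
rewrite /transfer; case: (split_ordP a) => i ->; case: (split_ordP b) => i' ->.
- under eq_fun do rewrite block_mxEul; exact: (laurent_cst (_ : C)).
- under eq_fun do rewrite block_mxEur; exact: (laurent_cst (_ : C)).
- under eq_fun do rewrite block_mxEdl; exact: (laurent_cst (_ : C)).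
- by under eq_fun do rewrite block_mxEdr.
Qed.

End Floquet.

(** * Perturbation of eigenvalues *)

Section Weyl.
Variables (R : realType) (N : nat).
Notation C := R[i].
Implicit Types (M E : 'M[C]_N) (x y : 'rV[C]_N).

Definition adj x : 'cV[C]_N := map_mx Num.conj x^T.

Definition sqnorm x : R := \sum_i normc (x 0 i) ^+ 2.

Definition quad M x : R := complex.Re ((x *m M *m adj x) 0 0).

Definition eigs M : seq R :=
  sort <=%R [seq complex.Re (spectral_diag M 0 i) | i <- enum 'I_N].

Lemma mul_conj_normc (c : C) : c * Num.conj c = real_complex R (normc c ^+ 2).
Proof.
case: c => a b /=; rewrite sqr_sqrtr ?addr_ge0 ?sqr_ge0 //.
by apply/eqP; rewrite eq_complex /=; apply/andP; split; apply/eqP; ring.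
Qed.

Lemma mul_adj x : (x *m adj x) 0 0 = real_complex R (sqnorm x).
Proof.
rewrite mxE /sqnorm rmorph_sum; apply: eq_bigr => i _.
by rewrite !mxE mul_conj_normc.
Qed.

Lemma quadB M E x : quad (M - E) x = quad M x - quad E x.
Proof. by rewrite /quad mulmxBr mulmxBl mxE [X in _ + X]mxE raddfB. Qed.

Lemma sqnorm_gt0 x : x != 0 -> 0 < sqnorm x.
Proof.
move=> x0; rewrite lt_neqAle sumr_ge0 ?andbT; last by move=> i _; exact: sqr_ge0.
apply: contra_neq x0 => /esym/eqP; rewrite psumr_eq0 => [/allP h|i _]; last exact: sqr_ge0.
apply/rowP => i; rewrite mxE; apply: eq0_normc; apply/eqP.
by have := h i (mem_index_enum _); rewrite sqrf_eq0.
Qed.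

Lemma quad_le E x : `|quad E x| <= (\sum_i \sum_k normc (E i k)) * sqnorm x.
Proof.
have Re_le (c : C) : `|complex.Re c| <= normc c.
  case: c => a b /=; rewrite -sqrtr_sqr ler_wsqrtr // lerDl; exact: sqr_ge0.
apply: le_trans (Re_le _) _.
rewrite mxE; under eq_bigr do rewrite mxE mulr_suml.
apply: le_trans (le_normc_sum _ _) _; rewrite mulr_suml.
apply: le_trans (ler_sum _ (fun i _ => le_normc_sum _ _)) _.
rewrite exchange_big /=; apply: ler_sum => i _; rewrite mulr_suml.
apply: ler_sum => k _; rewrite !mxE !normcM.
have -> : normc (Num.conj (x 0 k)) = normc (x 0 k).
  by case: (x 0 k) => a b /=; rewrite sqrrN.
have le1 l : normc (x 0 l) ^+ 2 <= sqnorm x.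
  by rewrite /sqnorm (bigD1 l) //= lerDl sumr_ge0 // => ? _; exact: sqr_ge0.
have h : normc (x 0 i) * normc (x 0 k) <= sqnorm x.
  have := le1 i; have := le1 k; have := sqr_ge0 (normc (x 0 i) - normc (x 0 k)); nra.
have := ler_wpM2l (normc_ge0 (E i k)) h; apply: le_trans.
by rewrite le_eqVlt; apply/orP; left; apply/eqP; ring.
Qed.

Section Spectral.
Variable M : 'M[C]_N.
Hypothesis hM : M \is hermsymmx.
Let P := spectralmx M.
Let D i : R := complex.Re (spectral_diag M 0 i).

Let uP : P \in unitmx. Proof. exact: spectral_unit. Qed.

Let invP : invmx P = map_mx Num.conj P^T.
Proof. exact/invmx_unitary/spectral_unitarymx. Qed.

Lemma adj_coord x : P *m adj x = adj (x *m invmx P).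
Proof.
rewrite /adj trmx_mul map_mxM invP; congr (_ *m _).
apply/matrixP => i k; by rewrite !mxE /= conjCK.
Qed.

Lemma sqnorm_coord x : sqnorm (x *m invmx P) = sqnorm x.
Proof.
have : real_complex R (sqnorm (x *m invmx P)) = real_complex R (sqnorm x).
  by rewrite -!mul_adj -adj_coord !mulmxA mulmxKV.
by case.
Qed.

Lemma quad_coord x : quad M x = \sum_i D i * normc ((x *m invmx P) 0 i) ^+ 2.
Proof.
rewrite /quad {1}(orthomx_spectralP (hermitian_normalmx hM)).
rewrite !mulmxA -mulmxA adj_coord mxE raddf_sum; apply: eq_bigr => i _.
rewrite mul_mx_diag !mxE.
have /mxOverP/(_ 0 i) := hermitian_spectral_diag_real hM.
move=> /RRe_real dr; rewrite -/P -[spectral_diag M 0 i]dr -/(D i).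
rewrite [_ * real_complex R _]mulrC -mulrA mul_conj_normc /=.
by rewrite mul0r subr0.
Qed.

End Spectral.

Lemma count_sorted_gt (s : seq R) j : sorted <=%R s -> (j < size s)%N ->
  (count (fun t => nth 0 s j < t)%R s <= size s - j.+1)%N.
Proof.
move=> ss js; rewrite -{2}(cat_take_drop j.+1 s) count_cat.
rewrite (_ : count _ (take _ _) = 0%N) ?add0n; last first.
  apply/eqP; rewrite -leqn0 leqNgt -has_count; apply/hasPn => t.
  move=> tin; have := tin; rewrite -index_mem size_take_min leq_min => /andP[ij lti].
  rewrite -(nth_index 0 tin) nth_take // -leNgt; apply: sorted_leq_nth => //; exact: le_trans.
by rewrite (leq_trans (count_size _ _)) // size_drop.
Qed.

Lemma count_sorted_lt (s : seq R) j : sorted <=%R s -> (j < size s)%N ->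
  (count (fun t => t < nth 0 s j)%R s <= j)%N.
Proof.
move=> ss js; rewrite -{2}(cat_take_drop j s) count_cat addnC.
rewrite (_ : count _ (drop _ _) = 0%N) ?add0n; last first.
  apply/eqP; rewrite -leqn0 leqNgt -has_count; apply/hasPn => t.
  move=> tin; have := tin; rewrite -index_mem size_drop => ij.
  rewrite -(nth_index 0 tin) nth_drop -leNgt; apply: sorted_leq_nth => //; rewrite ?inE ?leq_addr //; last by rewrite -ltn_subRL.
  exact: le_trans.
by rewrite (leq_trans (count_size _ _)) // size_take_min geq_minl.
Qed.

Lemma weyl M E (j : 'I_N) : M \is hermsymmx -> E \is hermsymmx ->
  nth 0 (eigs E) j <= nth 0 (eigs M) j + \sum_i \sum_k normc (E i k - M i k).
Proof.
move=> hM hE.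
pose D i := complex.Re (spectral_diag M 0 i).
pose G i := complex.Re (spectral_diag E 0 i).
pose I := [set i | (nth 0 (eigs M) j < D i)%R]%SET.
pose J := [set i | (G i < nth 0 (eigs E) j)%R]%SET.
have szM : size (eigs M) = N by rewrite size_sort size_map size_enum_ord.
have szE : size (eigs E) = N by rewrite size_sort size_map size_enum_ord.
have cI : (#|I| <= N - j.+1)%N.
  apply: (@leq_trans (size (eigs M) - j.+1)); last by rewrite szM.
  apply: leq_trans (count_sorted_gt (s := eigs M) (j := j) _ _).
  - rewrite cardsE cardE size_filter /eigs.
    by rewrite [leqRHS](permP (permEl (perm_sort _ _))) count_map -enumT.
  - exact: sort_le_sorted.
  - by rewrite szM.
have cJ : (#|J| <= j)%N.
  apply: leq_trans (count_sorted_lt (s := eigs E) (j := j) _ _).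
  - rewrite cardsE cardE size_filter /eigs.
    by rewrite [leqRHS](permP (permEl (perm_sort _ _))) count_map -enumT.
  - exact: sort_le_sorted.
  - by rewrite szE.
pose K : 'M[C]_(N, #|I| + #|J|) :=
  row_mx (colsub (fun i : 'I_#|I| => enum_val i) (invmx (spectralmx M)))
         (colsub (fun i : 'I_#|J| => enum_val i) (invmx (spectralmx E))).
have [x x0 xK] : exists2 x : 'rV[C]_N, x != 0 & x *m K = 0.
  have rk : kermx K != 0.
    rewrite -mxrank_eq0 mxrank_ker subn_eq0 -ltnNge.
    have jN := ltn_ord j.
    by apply: leq_ltn_trans (rank_leq_col K) _; lia.
  have [i hi] : exists i, row i (kermx K) != 0.
    apply: contrapT => hno; move/eqP: rk; apply; apply/row_matrixP => i.
    by rewrite row0; apply/eqP/negPn/negP => h; apply: hno; exists i.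
  by exists (row i (kermx K)) => //; rewrite -row_mul mulmx_ker row0.
have xI i : i \in I -> (x *m invmx (spectralmx M)) 0 i = 0.
  move=> iI; have := congr1 (fun r : 'rV[C]__ => r 0 (lshift _ (enum_rank_in iI i))) xK.
  rewrite mul_mx_row row_mxEl !mxE => e; rewrite -[RHS]e; apply: eq_bigr => k _.
  by rewrite ?mxE enum_rankK_in.
have xJ i : i \in J -> (x *m invmx (spectralmx E)) 0 i = 0.
  move=> iI; have := congr1 (fun r : 'rV[C]__ => r 0 (rshift _ (enum_rank_in iI i))) xK.
  rewrite mul_mx_row row_mxEr !mxE => e; rewrite -[RHS]e; apply: eq_bigr => k _.
  by rewrite ?mxE enum_rankK_in.
have q1 : quad M x <= nth 0 (eigs M) j * sqnorm x.
  rewrite quad_coord // -(sqnorm_coord M) mulr_sumr ler_sum // => i _.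
  have [iI|iI] := boolP (i \in I); first by rewrite xI // normc0 expr0n !mulr0.
  rewrite ler_wpM2r ?sqr_ge0 //; by move: iI; rewrite inE -leNgt.
have q2 : nth 0 (eigs E) j * sqnorm x <= quad E x.
  rewrite quad_coord // -(sqnorm_coord E) mulr_sumr ler_sum // => i _.
  have [iI|iI] := boolP (i \in J); first by rewrite xJ // normc0 expr0n !mulr0.
  rewrite ler_wpM2r ?sqr_ge0 //; by move: iI; rewrite inE -leNgt.
have s0 := sqnorm_gt0 x0.
rewrite -(ler_pM2r s0) (le_trans q2) // mulrDl -lerBlDl.
apply: (@le_trans _ _ (quad E x - quad M x)); first by rewrite lerD2l lerN2.
rewrite -quadB; apply: le_trans (ler_norm _) _; apply: le_trans (quad_le _ _) _.
rewrite ler_wpM2r ?(ltW s0) //; apply: ler_sum => i _; apply: ler_sum => k _.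
by rewrite !mxE.
Qed.

End Weyl.

(** * Sets of zero Hausdorff measure *)

Section Null.
Variables (R : realType) (d : nat).
Implicit Types (A B : set 'rV[R]_d) (s : R).

Definition hnull s A := forall delta eta : R, 0 < delta -> 0 < eta ->
  exists U : nat -> set 'rV[R]_d,
   [/\ A `<=` \bigcup_k U k, forall k, (diam (U k) <= delta%:E)%E &
       (\sum_(0 <= k <oo) poweR (diam (U k)) s <= eta%:E)%E].

Lemma hausdorff_content_ge0 s delta A : (0 <= hausdorff_content s delta A)%E.
Proof.
apply: le_ereal_inf_tmp => _ [U _ <-].
by apply: nneseries_ge0 => n _ _; exact: poweR_ge0.
Qed.

Lemma hnull_measure0 s A : hnull s A -> hausdorff_measure s A = 0%E.
Proof.
move=> hA; rewrite /hausdorff_measure.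
have -> : [set hausdorff_content s delta A | delta in [set delta : R | 0 < delta]]
    = [set 0%E].
  have c0 delta : 0 < delta -> hausdorff_content s delta A = 0%E.
    move=> d0; apply/eqP; rewrite eq_le hausdorff_content_ge0 andbT.
    apply/lee_addgt0Pr => eta eta0; rewrite add0e.
    have [U [AU dU sU]] := hA _ _ d0 eta0.
    by apply: le_trans sU; apply: ereal_inf_lbound; exists U.
  apply/seteqP; split=> [_ [delta d0 <-]|_ ->] /=; first exact: c0.
  by exists 1 => //; exact: c0.
exact: ereal_sup1.
Qed.

Lemma sub_hnull s A B : A `<=` B -> hnull s B -> hnull s A.
Proof.
move=> AB hB delta eta d0 e0; have [U [BU dU sU]] := hB _ _ d0 e0.
by exists U; split => //; exact: subset_trans AB BU.
Qed.

Lemma hnull_bigcup s (F : nat -> set 'rV[R]_d) :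
  (forall n, hnull s (F n)) -> hnull s (\bigcup_n F n).
Proof.
move=> hF delta eta d0 e0.
have /choice[U hU] : forall n, exists U : nat -> set 'rV[R]_d,
   [/\ F n `<=` \bigcup_k U k, forall k, (diam (U k) <= delta%:E)%E &
       (\sum_(0 <= k <oo) poweR (diam (U k)) s <= (eta / (2 ^ n.+1)%:R)%:E)%E].
  by move=> n; apply: hF => //; rewrite divr_gt0 // ltr0n expn_gt0.
have /card_esym/ppcard_eqP[f] := card_nat2.
exists (fun n => U (f n).1 (f n).2); split=> [x [n _ Fx]|n|].
- have [Fn _ _] := hU n; have [k _ Ux] := Fn x Fx.
  by exists (f^-1%FUN (n, k)) => //=; rewrite invK ?inE.
- by have [_ + _] := hU (f n).1; apply.
have p0 (p : nat * nat) : (0 <= poweR (diam (U p.1 p.2)) s)%E by exact: poweR_ge0.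
rewrite nneseries_esumT => [|n]; last exact: (p0 (f n)).
rewrite -(@reindex_esum R _ _ setT setT f (fun p => poweR (diam (U p.1 p.2)) s)) //.
apply: le_trans (epsilon_trick0 xpredT (ltW e0)).
have -> : [set: nat * nat] = [set: nat] `*`` (fun=> [set: nat]).
  by apply/seteqP; split.
rewrite -(esum_esum (a := fun i j => poweR (diam (U i j)) s)) => [|i j _ _]; last exact: poweR_ge0.
rewrite nneseries_esumT => [|n].
  apply: le_esum => n _; have [_ _] := hU n; rewrite nneseries_esumT //.
  by move=> k; exact: poweR_ge0.
by rewrite lee_fin divr_ge0 // ltW.
Qed.

Lemma hnull_countable (T : countType) s (F : T -> set 'rV[R]_d) :
  hnull s set0 -> (forall t, hnull s (F t)) -> hnull s (\bigcup_t F t).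
Proof.
move=> h0 hF.
apply: (@sub_hnull _ _ (\bigcup_n (if unpickle n is Some t then F t else set0))).
  by move=> x [t _ Ft]; exists (pickle t) => //; rewrite pickleK.
by apply: hnull_bigcup => n; case: unpickle.
Qed.

Lemma diam_le (U : set 'rV[R]_d) (r : R) : 0 <= r ->
  (forall x y, U x -> U y -> enorm (x - y) <= r) -> (diam U <= r%:E)%E.
Proof.
move=> r0 h; apply: ge_ereal_sup => _ [->|[[x y] [/= Ux Uy] <-]]; rewrite lee_fin //.
exact: h.
Qed.

Lemma diam_ge0 (U : set 'rV[R]_d) : (0 <= diam U)%E.
Proof. by apply: ereal_sup_ubound; left. Qed.

Lemma poweR_diam_le (U : set 'rV[R]_d) (r s : R) : 0 <= r -> 0 <= s ->
  (diam U <= r%:E)%E -> (poweR (diam U) s <= (r `^ s)%:E)%E.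
Proof.
move=> r0 s0; case E : (diam U) => [t||] //; last by have := diam_ge0 U; rewrite E.
rewrite lee_fin poweR_EFin lee_fin => tr.
have t0 : 0 <= t by rewrite -lee_fin -E diam_ge0.
by apply: ge0_ler_powR.
Qed.

Lemma diam_set0 : diam (set0 : set 'rV[R]_d) = 0%E.
Proof.
apply/eqP; rewrite eq_le diam_ge0 andbT; exact: (diam_le (r := 0)).
Qed.

Lemma finite_cover_sum s (G : finType) (W : G -> set 'rV[R]_d) (r : R) :
  0 < s -> 0 <= r -> (forall g, (diam (W g) <= r%:E)%E) ->
  exists U : nat -> set 'rV[R]_d, [/\ \bigcup_g W g `<=` \bigcup_k U k,
    forall k, (diam (U k) <= r%:E)%E &
    (\sum_(0 <= k <oo) poweR (diam (U k)) s <= (#|G|%:R * r `^ s)%:E)%E].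
Proof.
move=> s0 r0 hW.
pose U k := if insub k is Some i then W (enum_val (i : 'I_#|G|)) else set0.
have dU k : (diam (U k) <= r%:E)%E.
  by rewrite /U; case: insub => [i|]; rewrite ?diam_set0.
exists U; split => //.
  move=> x [g _ Wx]; exists (enum_rank g) => //.
  by rewrite /U valK /= enum_rankK.
have p0 k : (0 <= poweR (diam (U k)) s)%E by exact: poweR_ge0.
rewrite (nneseries_split 0 #|G|) // add0n.
rewrite [X in (_ + X)%E]eseries0 => [|k Gk _]; last first.
  by rewrite /U insubF ?ltnNge ?Gk // diam_set0 poweR0r // gt_eqF.
rewrite adde0; apply: (@le_trans _ _ (\sum_(0 <= k < #|G|) (r `^ s)%:E)%E).
  by apply: lee_sum => k _; apply: poweR_diam_le => //; exact: ltW.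
by rewrite sumEFin lee_fin sumr_const_nat subn0 mulr_natl.
Qed.

Lemma hnull0 s : 0 < s -> hnull s set0.
Proof.
move=> s0 delta eta d0 e0.
exists (fun=> set0); split=> // [k|]; first by rewrite diam_set0 lee_fin ltW.
by rewrite eseries0 ?lee_fin ?ltW // => k _ _; rewrite diam_set0 poweR0r // gt_eqF.
Qed.

Lemma hnull_grid s (I : finType) (T : 'rV[R]_d -> I -> R) (rho c : R) A :
  0 < s -> #|I|%:R < s -> 0 < c ->
  (forall x i, A x -> `|T x i| <= rho) ->
  (forall x y b, A x -> A y -> (forall i, `|T x i - T y i| <= b) -> 0 <= b ->
     enorm (x - y) <= c * b) ->
  hnull s A.
Proof.
move=> s0 sI c0 hrho hT delta eta d0 e0.
pose w := 2 * (`|rho| + 1).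
have w0 : 0 < w by rewrite mulr_gt0 // ltr_wpDl.
pose m := #|I|; pose e := s - m%:R.
have epos : 0 < e by rewrite subr_gt0.
pose q := (c * w) `^ s.
have q0 : 0 < q by rewrite powR_gt0 // mulr_gt0.
pose b := Num.max (c * w / delta) ((q / eta) `^ e^-1).
have b0 : 0 < b by rewrite lt_max divr_gt0 // mulr_gt0.
have [K hK] : exists K : nat, b < K%:R.
  by exists (Num.truncn b).+1; exact: truncnS_gt.
have K0 : 0 < K%:R :> R by exact: lt_trans hK.
pose r := c * (w / K%:R).
have r0 : 0 <= r by rewrite !mulr_ge0 ?invr_ge0 // ltW.
have rd : r <= delta.
  have h : c * w / delta < K%:R by apply: le_lt_trans hK; rewrite le_max lexx.
  by rewrite /r mulrA ler_pdivrMr // [leRHS]mulrC -ler_pdivrMr // ltW.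
pose W (g : {ffun I -> 'I_K}) : set 'rV[R]_d :=
  [set x | A x /\ forall i, (g i)%:R <= (T x i + w / 2) * (K%:R / w) < (g i).+1%:R].
have hW g : (diam (W g) <= r%:E)%E.
  apply: diam_le => // x y [Ax hx] [Ay hy]; apply: hT => // [i|]; last first.
    by rewrite divr_ge0 ?ltW.
  have /andP[x1 x2] := hx i; have /andP[y1 y2] := hy i.
  move: x1 x2 y1 y2; rewrite -natr1.
  have -> : T x i - T y i = ((T x i + w / 2) * (K%:R / w) - (T y i + w / 2) * (K%:R / w)) * (w / K%:R).
    by field; rewrite !gt_eqF.
  have wK : 0 <= w / K%:R by rewrite divr_ge0 ?ltW.
  rewrite normrM (ger0_norm wK).
  move: (_ * (K%:R / w)) (_ * (K%:R / w)) => X Y x1 x2 y1 y2.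
  rewrite ler_piMl // ler_norml.
  by apply/andP; split; lra.
have [U [WU dU sU]] := finite_cover_sum s0 r0 hW.
exists U; split.
- apply: subset_trans WU => x Ax.
  have T0 i : 0 <= T x i + w / 2 < w.
    have := hrho x i Ax; have := ler_norm rho; rewrite ler_norml /w; lra.
  have TK0 i : 0 <= (T x i + w / 2) * (K%:R / w).
    by have /andP[? _] := T0 i; rewrite mulr_ge0 // divr_ge0 // ltW.
  have hi i : (Num.truncn ((T x i + w / 2) * (K%:R / w)) < K)%N.
    rewrite truncn_lt_nat // mulrA ltr_pdivrMr // [ltRHS]mulrC ltr_pM2r //.
    by have /andP[] := T0 i.
  exists [ffun i => Ordinal (hi i)] => //; split => // i; rewrite ffunE /=.
  exact: truncn_itv.
- by move=> k; apply: le_trans (dU k) _; rewrite lee_fin.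
- apply: le_trans sU _; rewrite lee_fin card_ffun card_ord -/m.
  rewrite /r mulrA powRM ?mulr_ge0 ?invr_ge0 ?(ltW c0) ?(ltW w0) ?(ltW K0) // -/q.
  have -> : K%:R^-1 `^ s = (K%:R `^ s)^-1 :> R.
    by rewrite -powR_inv1 ?ltW // -powRrM mulN1r powRN.
  have -> : (K ^ m)%:R = K%:R `^ m%:R :> R by rewrite powR_mulrn ?ltW // natrX.
  have hKs : K%:R `^ s = K%:R `^ m%:R * K%:R `^ e :> R.
    by rewrite -powRD ?gt_eqF ?implybT // /e addrC subrK.
  rewrite hKs; have Km : 0 < K%:R `^ m%:R :> R by exact: powR_gt0.
  have Ke : q / eta <= K%:R `^ e.
    have h : (q / eta) `^ e^-1 <= K%:R.
      by apply/ltW; apply: le_lt_trans hK; rewrite le_max lexx orbT.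
    have := ge0_ler_powR (ltW epos) (powR_ge0 _ _) (ltW K0) h.
    by rewrite -powRrM mulVf ?gt_eqF // powRr1 // divr_ge0 ?ltW.
  have Ke0 : 0 < K%:R `^ e :> R by exact: powR_gt0.
  have -> : K%:R `^ m%:R * (q / (K%:R `^ m%:R * K%:R `^ e)) = q / K%:R `^ e.
    by field; rewrite !gt_eqF.
  by rewrite ler_pdivrMr // [leRHS]mulrC -ler_pdivrMr.
Qed.

Lemma hausdorff_dim_le A (m : R) : 0 <= m ->
  (forall s, 0 < s -> m < s -> hnull s A) -> (hausdorff_dim A <= m%:E)%E.
Proof.
move=> m0 h; apply/lee_addgt0Pr => e e0; apply: ereal_inf_lbound.
exists (m + e) => //; have me : m < m + e by rewrite ltrDl.
by split; [exact: le_lt_trans me|apply/hnull_measure0/h => //; exact: le_lt_trans me].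
Qed.

End Null.

(** * Common zeros of two trigonometric polynomials *)

Section Pieces.
Variables (R : realType) (d : nat).
Notation C := R[i].
Implicit Types (s : seq (C * 'rV[int]_d)) (th x y h w : 'rV[R]_d).

Lemma enorm_le_vnorm x : enorm x <= vnorm x.
Proof.
rewrite /enorm -[leRHS]ger0_norm ?vnorm_ge0 // -sqrtr_sqr ler_wsqrtr //.
rewrite expr2 {1}/vnorm mulr_suml; apply: ler_sum => k _.
rewrite -expr2 -real_normK ?num_real // expr2 ler_wpM2l //.
by rewrite /vnorm (bigD1 k) //= lerDl sumr_ge0.
Qed.

Lemma vnormD x y : vnorm (x + y) <= vnorm x + vnorm y.
Proof. by rewrite -big_split; apply: ler_sum => k _; rewrite mxE ler_normD. Qed.

Lemma vnormZ (a : R) x : vnorm (a *: x) = `|a| * vnorm x.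
Proof. by rewrite mulr_sumr; apply: eq_bigr => k _; rewrite mxE normrM. Qed.

Lemma vnorm_basis (k : 'I_d) : vnorm (delta_mx 0 k : 'rV[R]_d) = 1.
Proof.
rewrite /vnorm (bigD1 k) //= big1 ?addr0 => [|l lk]; first by rewrite mxE !eqxx normr1.
by rewrite mxE (negPf lk) andbF normr0.
Qed.

(* A replacement for the implicit function theorem: where [D_v f] is bounded below, nearby
   zeros of [f] differ along [v] by at most a multiple of their transverse distance. *)
Lemma transversal_bound v s (c : R) : 0 < c -> exists2 e, 0 < e & exists2 K, 0 < K &
  forall x (t : R) w, trig s x = 0 -> trig s (x + t *: v + w) = 0 ->
    c < normc (trig (dtrig v s) x) -> `|t| <= e -> `|t| <= K * vnorm w.
Proof.
move=> c0; have [L L0 hL] := trig_lip s; have [M M0 hM] := trig_taylor v s.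
exists (c / (2 * M)); first by rewrite divr_gt0 // mulr_gt0.
exists (2 * L / c); first by rewrite divr_gt0 // mulr_gt0.
move=> x t w fx fy cD te.
have h1 := hL (x + t *: v) w; have h2 := hM x t.
rewrite fy sub0r normc_opp in h1; rewrite fx subr0 in h2.
have h3 := normc_lowerB (real_complex R t * trig (dtrig v s) x) (trig s (x + t *: v)).
rewrite -[normc (_ - _)]normc_opp opprB normcM normc_real in h3.
have h4 : `|t| * c <= `|t| * normc (trig (dtrig v s) x) by rewrite ler_wpM2l // ltW.
have h5 : M * t ^+ 2 <= `|t| * (c / 2).
  rewrite -(real_normK (num_real t)) expr2 mulrCA ler_wpM2l //.
  by move: te; rewrite ler_pdivlMr ?mulr_gt0 //; lra.
rewrite mulrAC ler_pdivlMr //; lra.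
Qed.

Section Piece.
Variables (j k : 'I_d) (v : 'rV[R]_d).
Hypothesis kj : k != j.
Hypothesis vj : v 0 j = 0.
Hypothesis vk : v 0 k != 0.

Let I := {l : 'I_d | (l != j) && (l != k)}.

Let T x (l : I) : R := x 0 (val l) - x 0 k / v 0 k * v 0 (val l).

Lemma card_transverse : #|{: I}| = d.-2.
Proof.
rewrite card_sig.
have -> : #|[pred l : 'I_d | (l != j) && (l != k)]| = #|[predC [pred l | l \in [set j; k]%SET]]|.
  by apply: eq_card => l; rewrite !inE negb_or.
have := cardC [pred l | l \in [set j; k]%SET].
rewrite card_ord; have -> : #|[pred l | l \in [set j; k]%SET]| = 2%N.
  by rewrite (eq_card (B := [set j; k]%SET)) // cards2 eq_sym kj.
by move=> /(congr1 (fun n => n - 2)%N); rewrite addKn subn2.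
Qed.

Lemma piece_hnull s1 s2 (c sigma : R) :
  0 < c -> 0 < sigma -> d%:R - 2 < sigma ->
  (forall t, t \in s2 -> t.2 0 j = 0) ->
  hnull sigma [set x | [/\ trig s1 x = 0, c < normc (trig (dtrig (delta_mx 0 j) s1) x),
     trig s2 x = 0 & c < normc (trig (dtrig v s2) x)]].
Proof.
move=> c0 sig0 sigd s2j.
have [e1 e10 [K1 K10 h1]] := transversal_bound (delta_mx 0 j) s1 c0.
have [e2 e20 [K2 K20 h2]] := transversal_bound v s2 c0.
set S := [set x | _].
pose e := Num.min e1 (e2 * `|v 0 k|).
have e0 : 0 < e by rewrite lt_min e10 mulr_gt0 ?normr_gt0.
pose cube (u : 'rV[int]_d) : set 'rV[R]_d := [set x | forall i, Num.floor (x 0 i / e) = u 0 i].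
suff hc u : hnull sigma (S `&` cube u).
  apply: (sub_hnull _ (hnull_countable (hnull0 _ sig0) hc)) => x Sx.
  exists (\row_i Num.floor (x 0 i / e)) => //; split => // i; by rewrite mxE.
have cubeE x i : cube u x -> (u 0 i)%:~R * e <= x 0 i < (u 0 i + 1)%:~R * e.
  move=> /(_ i) <-; have := floor_itv (x 0 i / e).
  by rewrite ler_pdivlMr // ltr_pdivrMr.
pose B := \sum_i (`|(u 0 i)%:~R| + 1) * e.
have xB x i : cube u x -> `|x 0 i| <= B.
  move=> ux; apply: (@le_trans _ _ ((`|(u 0 i)%:~R| + 1) * e)); last first.
    rewrite /B (bigD1 i) //= lerDl sumr_ge0 // => l _.
    by rewrite mulr_ge0 ?addr_ge0 ?(ltW e0).
  have /andP[x1 x2] := cubeE x i ux; rewrite intrD in x2.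
  have n1 : 0 <= (`|(u 0 i)%:~R| - (u 0 i)%:~R) * e.
    by rewrite mulr_ge0 ?(ltW e0) // subr_ge0 ler_norm.
  have n2 : 0 <= (`|(u 0 i)%:~R| + (u 0 i)%:~R) * e.
    by rewrite mulr_ge0 ?(ltW e0) // -lerBlDr sub0r -normrN ler_norm.
  by rewrite ler_norml; apply/andP; split; lra.
pose K := (K2 * vnorm v + K1 * (K2 * vnorm v + 1) + 1).
have K0 : 0 < K.
  by rewrite ltr_wpDl // addr_ge0 ?mulr_ge0 ?addr_ge0 ?mulr_ge0 ?vnorm_ge0 ?(ltW K10) ?(ltW K20).
have card0 : (0 < d)%N by case: (d) j => [[]|].
have dpos : 0 < d%:R :> R by rewrite ltr0n.
apply: (@hnull_grid _ _ _ _ T (B + \sum_l B / `|v 0 k| * `|v 0 l|) (K * d%:R)) => //.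
- rewrite card_transverse -subn2 natrB //.
  by have := max_card [set j; k]%SET; rewrite cards2 eq_sym kj card_ord.
- exact: mulr_gt0.
- move=> x l [_ ux]; apply: le_trans (ler_normB _ _) _; apply: lerD; first exact: xB.
  rewrite normrM normrM normfV [leRHS](bigD1 (val l)) //=.
  apply: (@le_trans _ _ (B / `|v 0 k| * `|v 0 (val l)|)).
    by rewrite ler_wpM2r // ler_wpM2r ?invr_ge0 // xB.
  have B0 : 0 <= B by exact: le_trans (xB x j ux).
  by rewrite lerDl sumr_ge0 // => i _; rewrite mulr_ge0 // divr_ge0.
- move=> y x b [[fy Dy gy Ey] uy] [[fx Dx gx Ex] ux] hb b0.
  pose h := y - x; pose t := h 0 k / v 0 k.
  pose w : 'rV[R]_d := h - t *: v - h 0 j *: delta_mx 0 j.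
  have hE : h = t *: v + w + h 0 j *: delta_mx 0 j by rewrite /w; vec.
  have wE i : `|w 0 i| <= b.
    rewrite !mxE eqxx /=; have [->|ij] := eqVneq i j.
      by rewrite vj mulr0 subr0 mulr1 subrr normr0.
    rewrite mulr0 subr0; have [->|ik] := eqVneq i k.
      by rewrite /t !mxE divfK // subrr normr0.
    have ijk : (i != j) && (i != k) by rewrite ij.
    have := hb (exist _ i ijk); rewrite /T /t !mxE /=.
    apply: le_trans; rewrite le_eqVlt; apply/orP; left; apply/eqP; congr `|_|.
    by field.
  have wb : vnorm w <= d%:R * b.
    rewrite /vnorm (le_trans (ler_sum _ (fun i _ => wE i))) //.
    by rewrite sumr_const card_ord mulr_natl.
  have he i : `|h 0 i| <= e.
    have /andP[x1 x2] := cubeE x i ux; have /andP[y1 y2] := cubeE y i uy.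
    rewrite intrD in x2; rewrite intrD in y2.
    by rewrite !mxE ler_norml; apply/andP; split; lra.
  have te : `|t| <= K2 * vnorm w.
    apply: (h2 x) => //.
      rewrite -gy; have -> : y = x + t *: v + w + h 0 j *: delta_mx 0 j.
        by rewrite -2!addrA [t *: v + (w + _)]addrA -hE /h addrC subrK.
      apply: eq_big_seq => p /s2j p0; congr (_ * cis2pi _).
      rewrite [in RHS]dotvDl dotvZl.
      suff -> : dotv (delta_mx 0 j) (intv p.2) = 0 :> R by rewrite mulr0 addr0.
      rewrite /dotv big1 // => i _; rewrite !mxE; case: (i =P j) => [->|_].
        by rewrite p0 mulr0.
      by rewrite andbF mul0r.
    rewrite /t normrM normfV ler_pdivrMr ?normr_gt0 //.
    by apply: le_trans (he k) _; rewrite ge_min lexx orbT.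
  have hj : `|h 0 j| <= K1 * vnorm (t *: v + w).
    apply: (h1 x) => //; last by apply: le_trans (he j) _; rewrite ge_min lexx.
    rewrite -fy; congr (trig s1 _).
    by rewrite -addrA [_ + (_ + w)]addrC -hE /h addrC subrK.
  have v0 := vnorm_ge0 v; have w0 := vnorm_ge0 w.
  have tw : vnorm (t *: v + w) <= (K2 * vnorm v + 1) * vnorm w.
    apply: le_trans (vnormD _ _) _; rewrite vnormZ mulrDl mul1r lerD2r.
    by rewrite mulrAC ler_wpM2r.
  apply: le_trans (enorm_le_vnorm _) _; rewrite -/h {1}hE.
  apply: le_trans (vnormD _ _) _; rewrite vnormZ vnorm_basis mulr1.
  apply: (@le_trans _ _ ((K2 * vnorm v + 1) * vnorm w + K1 * ((K2 * vnorm v + 1) * vnorm w))).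
    apply: lerD => //; apply: le_trans hj _; rewrite ler_wpM2l // ltW //.
  have -> : (K2 * vnorm v + 1) * vnorm w + K1 * ((K2 * vnorm v + 1) * vnorm w) = K * vnorm w.
    by rewrite /K; ring.
  by rewrite -mulrA ler_wpM2l // ltW.
Qed.

Lemma zeros_hnull s1 s2 (sigma : R) (Z : set 'rV[R]_d) :
  0 < sigma -> d%:R - 2 < sigma ->
  (forall t, t \in s2 -> t.2 0 j = 0) ->
  (forall x, Z x -> trig s1 x = 0 /\ trig s2 x = 0) ->
  (forall x, Z x -> exists m, trig (iter m (dtrig (delta_mx 0 j)) s1) x != 0) ->
  (forall x, Z x -> exists m, trig (iter m (dtrig v) s2) x != 0) ->
  hnull sigma Z.
Proof.
move=> sig0 sigd s2j hZ hZ1 hZ2.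
have s2j' m t : t \in iter m (dtrig v) s2 -> t.2 0 j = 0.
  elim: m t => [|m IH] t; first exact: s2j.
  by rewrite iterS => /mapP[t' /IH t'0 ->].
pose F (p : nat * nat * nat) :=
  [set x | [/\ trig (iter p.1.1 (dtrig (delta_mx 0 j)) s1) x = 0,
     p.2.+1%:R^-1 < normc (trig (dtrig (delta_mx 0 j) (iter p.1.1 (dtrig (delta_mx 0 j)) s1)) x),
     trig (iter p.1.2 (dtrig v) s2) x = 0 &
     p.2.+1%:R^-1 < normc (trig (dtrig v (iter p.1.2 (dtrig v) s2)) x)]].
have hF p : hnull sigma (F p).
  apply: piece_hnull => //; last exact: s2j'.
apply: (sub_hnull _ (hnull_countable (hnull0 _ sig0) hF)) => x Zx.
have first w s : trig s x = 0 -> (exists m, trig (iter m (dtrig w) s) x != 0) ->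
    exists m, trig (iter m (dtrig w) s) x = 0 /\ trig (iter m.+1 (dtrig w) s) x != 0.
  move=> s0 ex; case: (ex_minnP ex) => -[|m]; first by rewrite /= s0 eqxx.
  move=> hm mmin; exists m; split => //.
  by apply/eqP/negPn/negP => /mmin; rewrite ltnn.
have [fx gx] := hZ x Zx.
have [a [fa fa1]] := first _ _ fx (hZ1 x Zx).
have [m [gm gm1]] := first _ _ gx (hZ2 x Zx).
have small z : z != 0 -> exists q : nat, forall q', (q <= q')%N -> q'.+1%:R^-1 < normc (z : C).
  move=> z0; have nz : 0 < normc z.
    by rewrite lt_neqAle normc_ge0 andbT eq_sym; apply: contra_neq z0 => /eq0_normc.
  exists (Num.truncn (normc z)^-1) => q' qq'.
  rewrite -[ltRHS]invrK ltf_pV2 ?posrE ?invr_gt0 ?ltr0n //.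
  by apply: lt_le_trans (truncnS_gt _) _; rewrite ler_nat.
have [q1 hq1] := small _ fa1; have [q2 hq2] := small _ gm1.
exists ((a, m), maxn q1 q2) => //; split => //=.
  by apply: hq1; rewrite leq_maxl.
by apply: hq2; rewrite leq_maxr.
Qed.

End Piece.
End Pieces.

(** * Second order vanishing at band edges *)

Section IsTrig.
Variables (R : realType) (d : nat).
Notation C := R[i].
Implicit Types (f g : 'rV[R]_d -> C).

Definition is_trig f := exists s, forall th, f th = trig s th.

Lemma is_trigD f g : is_trig f -> is_trig g -> is_trig (fun th => f th + g th).
Proof.
move=> [s hs] [r hr]; exists (s ++ r) => th.
by rewrite hs hr /trig big_cat.
Qed.

Lemma is_trigZ (c : C) f : is_trig f -> is_trig (fun th => c * f th).
Proof.
move=> [s hs]; exists [seq (c * t.1, t.2) | t <- s] => th.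
by rewrite hs /trig big_map mulr_sumr; apply: eq_bigr => t _; rewrite mulrA.
Qed.

Lemma is_trig_sum (I : finType) (f : I -> 'rV[R]_d -> C) :
  (forall i, is_trig (f i)) -> is_trig (fun th => \sum_i f i th).
Proof.
move=> /choice[s hs]; exists (flatten [seq s i | i <- enum I]) => th.
rewrite /trig big_flatten big_map big_enum /=.
by apply: eq_bigr => i _; rewrite hs.
Qed.

Lemma is_trig_bloch (A : 'M[int]_d) m n : is_trig (fun th => bloch A th m n).
Proof.
rewrite /bloch; case: asboolP => _; last by exists [::] => th; rewrite /trig big_nil.
by exists [:: (1, n - m)] => th; rewrite /trig big_seq1 mul1r.
Qed.

Lemma is_trig_floquet (A : 'M[int]_d) V i k :
  is_trig (fun th : 'rV[R]_d => floquet_mx A V th i k).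
Proof.
under eq_fun do rewrite mxE /schrodinger nbhd_sum.
apply: is_trigD; last exact/is_trigZ/is_trig_bloch.
apply: is_trig_sum => l; apply: is_trigD; exact: is_trig_bloch.
Qed.

Lemma is_trig_bounded f : is_trig f -> exists b, forall th, normc (f th) <= b.
Proof.
move=> [s hs]; exists (\sum_(t <- s) normc t.1) => th; rewrite hs.
apply: le_trans (le_normc_sum _ _) _; apply: ler_sum => t _.
by rewrite normcM normc_cis2pi mulr1.
Qed.

Lemma is_trig_lip f : is_trig f ->
  exists b, forall th h, normc (f (th + h) - f th) <= b * vnorm h.
Proof.
move=> [s hs]; have [b _ hb] := trig_lip s.
by exists b => th h; rewrite !hs.
Qed.

End IsTrig.

Section Products.
Variable R : realType.

Lemma same_sign_norm_le (a b : R) : 0 <= a * b -> `|a| <= `|a + b|.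
Proof.
have [a0|a0] := leP 0 a; have [b0|b0] := leP 0 b => ab.
- by rewrite !ger0_norm ?addr_ge0 // lerDl.
- have -> : a = 0 by nra.
  by rewrite normr0.
- have -> : b = 0 by nra.
  by rewrite addr0.
- rewrite !ltr0_norm; lra.
Qed.

Lemma product_dichotomy N (E : 'I_N -> R -> R) (i0 : 'I_N) (lam L : R) :
  0 <= L -> (forall i t, `|E i t - E i 0| <= L * `|t|) -> E i0 0 = lam ->
  (forall t, 0 <= (lam - E i0 t) * (lam - E i0 (- t))) ->
  (exists K, forall t, `|t| <= 1 -> `|\prod_i (lam - E i t)| <= K * t ^+ 2) \/
  (exists2 t0, 0 < t0 & forall t, `|t| <= t0 ->
     0 <= \prod_i (lam - E i t) * \prod_i (lam - E i (- t))).
Proof.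
move=> L0 lip Ei0 ext.
have [[i1 [i10 hi1]]|simple] := pselect (exists i, i != i0 /\ E i 0 = lam); [left|right].
  exists (L ^+ 2 * \prod_(i | (i != i0) && (i != i1)) (`|lam - E i 0| + L)) => t t1.
  rewrite (bigD1 i0) //= (bigD1 i1) //= mulrA normrM mulrAC; apply: ler_pM => //.
    rewrite normrM -(real_normK (num_real t)) -exprMn expr2.
    have b0 := lip i0 t; have b1 := lip i1 t.
    rewrite Ei0 distrC in b0; rewrite hi1 distrC in b1.
    exact: ler_pM.
  rewrite normr_prod; apply: ler_prod => i _; rewrite normr_ge0 /=.
  have -> : lam - E i t = (lam - E i 0) - (E i t - E i 0) by ring.
  apply: le_trans (ler_normB _ _) _; rewrite lerD2l; apply: le_trans (lip i t) _.
  by rewrite ler_piMr.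
have [e e0 he] : exists2 e, 0 < e & forall i, e <= if i == i0 then 1 else `|lam - E i 0|.
  apply: pos_lower_bound => i; case: eqP => [//|/eqP ii0].
  by rewrite normr_gt0 subr_eq0; apply/eqP => e; apply: simple; exists i.
have L1 : 0 < L + 1 by rewrite ltr_wpDl.
exists (e / (L + 1)); first by rewrite divr_gt0.
move=> t; rewrite ler_pdivlMr // => te.
rewrite -big_split /=; apply: prodr_ge0 => i _.
have [->|ii0] := eqVneq i i0; first exact: ext.
have := he i; rewrite (negPf ii0) => hei.
have l1 := lip i t; have l2 := lip i (- t); rewrite normrN in l2.
have te' : L * `|t| <= e by have := normr_ge0 t; lra.
have {l1}l1 := le_trans l1 (le_trans te' hei).
have {l2}l2 := le_trans l2 (le_trans te' hei).
move: l1 l2; rewrite !ler_norml; have [pos|neg] := leP 0 (lam - E i 0).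
  by rewrite ger0_norm // => /andP[_ a] /andP[_ b]; apply: mulr_ge0; lra.
by rewrite ltr0_norm // => /andP[a _] /andP[b _]; apply: mulr_le0; lra.
Qed.

End Products.

Section Bands.
Variables (R : realType) (d : nat) (A : 'M[int]_d) (V : 'rV[int]_d -> R).
Hypothesis rkA : full_rank R A.
Notation N := (nbands R A).
Notation C := R[i].
Implicit Types (th h : 'rV[R]_d) (i : 'I_N).

Lemma band_weyl i th th' : band V i th' <= band V i th +
  \sum_a \sum_b normc (floquet_mx A V th' a b - floquet_mx A V th a b).
Proof. exact: weyl (floquet_hermitian V th rkA) (floquet_hermitian V th' rkA). Qed.

Lemma band_lip : exists2 L, 0 < L & forall i th h,
  `|band V i (th + h) - band V i th| <= L * vnorm h.
Proof.
have /choice[L hL] : forall p : 'I_N * 'I_N, exists b, forall th h,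
    normc (floquet_mx A V (th + h) p.1 p.2 - floquet_mx A V th p.1 p.2) <= b * vnorm h.
  by move=> p; exact: is_trig_lip (is_trig_floquet V p.1 p.2).
have L0 p h : 0 <= L p * vnorm h by exact: le_trans (normc_ge0 _) (hL p 0 h).
exists (1 + \sum_a \sum_b `|L (a, b)|).
  by rewrite ltr_pwDl // sumr_ge0 // => a _; rewrite sumr_ge0.
move=> i th h; set K := \sum_a \sum_b _.
have bound th1 th2 : (forall p, normc (floquet_mx A V th2 p.1 p.2 - floquet_mx A V th1 p.1 p.2)
    <= L p * vnorm h) -> band V i th2 <= band V i th1 + K * vnorm h.
  move=> hp; apply: le_trans (band_weyl i th1 th2) _; rewrite lerD2l mulr_suml.
  apply: ler_sum => a _; rewrite mulr_suml; apply: ler_sum => b _.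
  apply: le_trans (hp (a, b)) _; rewrite ler_wpM2r ?vnorm_ge0 //; exact: ler_norm.
have h1 := bound th (th + h) (fun p => hL p th h).
have h2 : band V i th <= band V i (th + h) + K * vnorm h.
  by apply: bound => p; rewrite -normc_opp opprB; exact: hL.
have := vnorm_ge0 h; rewrite ler_norml; lra.
Qed.

Lemma band_bounded i : exists b, forall th th', `|band V i th - band V i th'| <= b.
Proof.
have /choice[b hb] : forall p : 'I_N * 'I_N, exists b, forall th,
    normc (floquet_mx A V th p.1 p.2) <= b.
  by move=> p; exact: is_trig_bounded (is_trig_floquet V p.1 p.2).
exists (\sum_a \sum_c (b (a, c) + b (a, c))).
have bound th1 th2 : band V i th2 <= band V i th1 + \sum_a \sum_c (b (a, c) + b (a, c)).
  apply: le_trans (band_weyl i th1 th2) _; rewrite lerD2l.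
  apply: ler_sum => a _; apply: ler_sum => c _.
  apply: le_trans (le_normcD _ _) _; rewrite normc_opp.
  by apply: lerD; exact: (hb (a, c)).
by move=> th th'; have := bound th th'; have := bound th' th; rewrite ler_norml; lra.
Qed.

Lemma band_min_le i th : band_min V i <= band V i th.
Proof.
have [b hb] := band_bounded i; apply: ge_inf; last by exists th.
exists (band V i th - b) => _ [th' _ <-].
by have := hb th th'; rewrite ler_norml; lra.
Qed.

Lemma band_max_ge i th : band V i th <= band_max V i.
Proof.
have [b hb] := band_bounded i; apply: sup_ubound; last by exists th.
exists (band V i th + b) => _ [th' _ <-].
by have := hb th th'; rewrite ler_norml; lra.
Qed.

Lemma det_floquet_bands th (lam : R) :
  \det (floquet_mx A V th - (real_complex R lam)%:M) =
  real_complex R ((-1) ^+ N * \prod_(i < N) (lam - band V i th)).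
Proof.
have -> : floquet_mx A V th - (real_complex R lam)%:M =
          (-1) *: ((real_complex R lam)%:M - floquet_mx A V th).
  by rewrite scaleN1r opprB.
rewrite detZ -horner_char_poly char_poly_floquet // horner_prod.
rewrite rmorphM rmorphXn rmorphN1 rmorph_prod; congr (_ * _).
by apply: eq_bigr => i _; rewrite hornerXsubC rmorphB.
Qed.

(* At an extremum of the band E_i0, det (h(theta) - lam) vanishes to second order along each
   line: either a second eigenvalue equals lam, or the other factors lam - E_i keep their
   signs and the determinant has a local extremum. *)
Lemma det_floquet_quadratic i0 th (lam : R) (v : 'rV[R]_d) s :
  (forall th1 th2, 0 <= (lam - band V i0 th1) * (lam - band V i0 th2)) ->
  band V i0 th = lam ->
  (forall th', \det (floquet_mx A V th' - (real_complex R lam)%:M) = trig s th') ->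
  exists K t0 : R, 0 < t0 /\ forall t : R, `|t| <= t0 ->
    normc (trig s (th + t *: v)) <= K * t ^+ 2.
Proof.
move=> hext hth hs.
have [L L0 hL] := band_lip.
pose E (i : 'I_N) t := band V i (th + t *: v).
have E0 i : E i 0 = band V i th by rewrite /E scale0r addr0.
have lip i t : `|E i t - E i 0| <= L * vnorm v * `|t|.
  by rewrite E0; apply: le_trans (hL i th (t *: v)) _; rewrite vnormZ mulrCA mulrC.
have Lv : 0 <= L * vnorm v by rewrite mulr_ge0 ?vnorm_ge0 // ltW.
pose G t := \prod_i (lam - E i t).
have FG t : trig s (th + t *: v) = real_complex R ((-1) ^+ N * G t).
  by rewrite -hs det_floquet_bands.
have nG t : normc (trig s (th + t *: v)) = `|G t|.
  by rewrite FG normc_real normrM normrX normrN1 expr1n mul1r.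
have Ei0 : E i0 0 = lam by rewrite E0.
have hext' t : 0 <= (lam - E i0 t) * (lam - E i0 (- t)) by exact: hext.
have [[K hK]|[t0 t00 ht0]] := product_dichotomy Lv lip Ei0 hext'.
  by exists K, 1; split => // t t1; rewrite nG; exact: hK.
have [M M0 hM] := trig_taylor v s.
exists (2 * M), t0; split => // t tt0.
have F0 : trig s th = 0.
  have := FG 0; rewrite scale0r addr0 => ->; rewrite /G (bigD1 i0) //= Ei0 subrr.
  by rewrite mul0r mulr0.
have t1 := hM th t; have t2 := hM th (- t).
rewrite F0 subr0 in t1; rewrite F0 subr0 sqrrN rmorphN mulNr opprK in t2.
have sum : normc (trig s (th + t *: v) + trig s (th + (- t) *: v)) <= 2 * M * t ^+ 2.
  have := le_normcD (trig s (th + t *: v) - real_complex R t * trig (dtrig v s) th)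
    (trig s (th + (- t) *: v) + real_complex R t * trig (dtrig v s) th).
  have -> : trig s (th + t *: v) - real_complex R t * trig (dtrig v s) th +
    (trig s (th + (- t) *: v) + real_complex R t * trig (dtrig v s) th) =
    trig s (th + t *: v) + trig s (th + (- t) *: v) by ring.
  move=> h; apply: le_trans h _; lra.
rewrite nG; apply: le_trans sum.
rewrite !FG -rmorphD normc_real -mulrDr normrM normrX normrN1 expr1n mul1r.
exact: same_sign_norm_le (ht0 t tt0).
Qed.

End Bands.

Section Roots.
Variable R : realType.
Notation C := R[i].
Implicit Types (p q : {poly C}) (x : C).

Lemma normc_horner_le p x : normc x = 1 -> normc p.[x] <= \sum_(i < size p) normc p`_i.
Proof.
move=> x1; rewrite horner_coef; apply: le_trans (le_normc_sum _ _) _.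
apply: ler_sum => i _; rewrite normcM; have -> : normc (x ^+ i) = 1.
  by elim: (val i) => [|n IH]; rewrite ?normc1 // exprS normcM IH x1 mulr1.
by rewrite mulr1.
Qed.

Lemma cis2pi_sub1_ge (t : R) : `|t| <= (8 * pi)^-1 -> pi * `|t| <= normc (cis2pi t - 1).
Proof.
have p0 := pi_gt0 R.
move=> ht; have h1 := cis2pi_taylor t.
have h2 := normc_lowerB (tau_i t) (tau_i t - (cis2pi t - 1)).
rewrite subKr in h2.
rewrite -normc_opp opprB in h1.
have h3 : normc (tau_i t) = 2 * pi * `|t|.
  by rewrite /= expr0n add0r sqrtr_sqr normrM ger0_norm // mulr_ge0 // ltW.
rewrite h3 in h2.
have h4 : `|t| * (8 * pi) <= 1 by rewrite -ler_pdivlMr ?mulr_gt0 // div1r.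
have h5 : 2 * (2 * pi * t) ^+ 2 <= pi * `|t|.
  have -> : 2 * (2 * pi * t) ^+ 2 = pi * `|t| * (`|t| * (8 * pi)).
    by rewrite exprMn -(real_normK (num_real t)); ring.
  by rewrite ler_piMr // mulr_ge0 // ltW.
lra.
Qed.

Lemma squeeze_eq0 (a K t0 : R) : 0 < t0 -> 0 <= a ->
  (forall t, 0 < t -> t <= t0 -> a <= K * t) -> a = 0.
Proof.
move=> t00 a0 h; apply/eqP; rewrite eq_le a0 andbT.
apply/ler_addgt0Pr => e e0; rewrite add0r.
have K1 : 0 < `|K| + 1 by rewrite ltr_wpDl.
pose t := Num.min t0 (e / (`|K| + 1)).
have t_gt0 : 0 < t by rewrite lt_min t00 divr_gt0.
apply: le_trans (h t t_gt0 _) _; first by rewrite ge_min lexx.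
apply: (@le_trans _ _ ((`|K| + 1) * t)).
  by rewrite ler_wpM2r ?(ltW t_gt0) // (le_trans (ler_norm K)) // lerDl.
by rewrite mulrC -ler_pdivlMr // ge_min lexx orbT.
Qed.

Lemma double_root p x K t0 : normc x = 1 -> 0 < t0 ->
  (forall t : R, `|t| <= t0 -> normc p.[x * cis2pi t] <= K * t ^+ 2) ->
  root p x /\ root p^`() x.
Proof.
move=> x1 t00 h.
have px : root p x.
  apply/rootP/eq0_normc/eqP; rewrite eq_le normc_ge0 andbT.
  by have := h 0; rewrite normr0 cis2pi0 mulr1 expr0n mulr0; apply; exact: ltW.
split => //; have [q pq] := factor_theorem _ _ px.
have qE : p^`().[x] = q.[x].
  by rewrite pq derivM derivXsubC mulr1 !hornerE subrr mulr0 add0r.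
apply/rootP; rewrite qE; apply: eq0_normc.
have /factor_theorem[r qr] : root (q - q.[x]%:P) x by rewrite rootE !hornerE subrr.
pose B := \sum_(i < size r) normc r`_i.
have p0 := pi_gt0 R.
have s0 : 0 < Num.min t0 (8 * pi)^-1 by rewrite lt_min t00 invr_gt0 mulr_gt0.
apply: (@squeeze_eq0 _ (K / pi + B * (4 * pi)) _ s0 (normc_ge0 _)) => t t_gt0.
rewrite le_min => /andP[tt0 tpi].
have nt : `|t| = t by rewrite gtr0_norm.
have y1 : normc (x * cis2pi t) = 1 by rewrite normcM x1 normc_cis2pi mulr1.
have yx : x * cis2pi t - x = x * (cis2pi t - 1) by rewrite mulrBr mulr1.
have lo : pi * t <= normc (cis2pi t - 1).
  by rewrite -[X in pi * X]nt; apply: cis2pi_sub1_ge; rewrite nt.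
have up := cis2pi_lip t; rewrite normrM nt ger0_norm ?mulr_ge0 ?(ltW p0) // in up.
have hq : normc q.[x * cis2pi t] <= K / pi * t.
  have := h t; rewrite nt => /(_ tt0); rewrite pq hornerM hornerXsubC yx !normcM x1 mul1r.
  have pt : 0 < pi * t by rewrite mulr_gt0.
  move=> hh; rewrite -(ler_pM2r pt).
  have -> : K / pi * t * (pi * t) = K * t ^+ 2 by rewrite mulrACA divfK ?gt_eqF.
  apply: le_trans hh.
  exact: ler_wpM2l (normc_ge0 _) _ _ lo.
have hr : normc (q.[x * cis2pi t] - q.[x]) <= B * (4 * pi) * t.
  have -> : q.[x * cis2pi t] - q.[x] = r.[x * cis2pi t] * (x * (cis2pi t - 1)).
    have := congr1 (fun f : {poly C} => f.[x * cis2pi t]) qr.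
    by rewrite hornerD hornerN !hornerC hornerM hornerXsubC yx.
  rewrite !normcM x1 mul1r -mulrA; apply: ler_pM; rewrite ?normc_ge0 //.
    exact: normc_horner_le.
  by apply: le_trans up _; rewrite le_eqVlt; apply/orP; left; apply/eqP; ring.
have := normc_lowerB q.[x] (q.[x] - q.[x * cis2pi t]).
rewrite subKr -[normc (q.[x] - _)]normc_opp opprB mulrDl; lra.
Qed.

Lemma exists_nonroot p x : p != 0 -> x != 0 -> exists t : R, ~~ root p (x * cis2pi t).
Proof.
move=> p0 x0; pose f (n : nat) : C := x * cis2pi (n.+2%:R^-1).
have finj : injective f.
  move=> m n /(mulfI x0) [] e _.
  have in0pi (k : nat) : 2 * pi * k.+2%:R^-1 \in `[0, pi : R].
    rewrite in_itv /= mulr_ge0 ?mulr_ge0 ?pi_ge0 ?invr_ge0 //=.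
    by rewrite ler_pdivrMr ?ltr0n // mulrC ler_wpM2l ?pi_ge0 // ler_nat.
  have := cos_inj (in0pi m) (in0pi n) e.
  move=> /(mulfI _); rewrite mulf_neq0 ?pnatr_eq0 // ?gt_eqF ?pi_gt0 // => /(_ isT).
  by move=> /invr_inj/eqP; rewrite eqr_nat => /eqP [].
pose rs := [seq f i | i <- iota 0 (size p)].
have : ~~ all (root p) rs.
  apply/negP => /(max_poly_roots p0)/implyP; rewrite map_inj_uniq ?iota_uniq //.
  by rewrite size_map size_iota ltnn.
by move=> /allPn[_ /mapP[n _ ->] h]; exists n.+2%:R^-1.
Qed.

Lemma resultant_double_root p x : p != 0 -> root p x -> root p^`() x ->
  resultant p p^`() = 0.
Proof.
move=> p0 px p'x; apply/eqP; rewrite resultant_eq0.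
by apply: (@root_size_gt1 _ x); rewrite ?root_gcd ?px // gcdp_eq0 (negPf p0).
Qed.

End Roots.

Section LevelSets.
Variables (R : realType) (d : nat) (A : 'M[int]_d) (V : 'rV[int]_d -> R).
Hypothesis rkA : full_rank R A.
Notation N := (nbands R A).
Notation C := R[i].
Implicit Types (th : 'rV[R]_d) (z : 'I_d -> C).

Definition discriminant j (D : 'M[C]_N) z : C :=
  resultant (char_poly (transfer j D z)) (char_poly (transfer j D z))^`().

Lemma transfer_indep j (D : 'M[C]_N) z z' : (forall k, k != j -> z k = z' k) ->
  transfer j D z = transfer j D z'.
Proof.
move=> h; suff e : hop A j z = hop A j z' by rewrite /transfer e.
by apply: eq_bigr => k /h ->.
Qed.

Lemma discriminant_trig (j : 'I_d) (D : 'M[C]_N) : (0 < N)%N ->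
  exists s : seq (C * 'rV[int]_d), (forall t, t \in s -> t.2 0 j = 0) /\
    forall z, (forall k, z k != 0) -> discriminant j D z = leval s z.
Proof.
move=> N0; have NN : (0 < N + N)%N by rewrite addn_gt0 N0.
have [s hs] := laurent_discriminant NN (laurent_transfer j D).
pose kill (n : 'rV[int]_d) : 'rV[int]_d := \row_k if k == j then 0 else n 0 k.
exists [seq (t.1, kill t.2) | t <- s]; split.
  by move=> _ /mapP[t _ ->]; rewrite mxE eqxx.
move=> z z0; pose z1 k := if k == j then 1 else z k.
have -> : discriminant j D z = discriminant j D z1.
  by rewrite /discriminant (@transfer_indep j D z z1) // => k /negPf kj; rewrite /z1 kj.
rewrite [LHS]hs; last by move=> k; rewrite /z1; case: ifP; rewrite ?oner_eq0.
rewrite /leval big_map; apply: eq_bigr => t _; congr (_ * _); apply: eq_bigr => k _.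
by rewrite /z1 mxE; case: ifP; rewrite ?exp1rz ?expr0z.
Qed.

Lemma level_set_hnull (j : 'I_d) (sg : 'I_d -> int) (i0 : 'I_N) (lam sigma : R) (Z : set 'rV[R]_d) :
  (2 <= d)%N -> is_sign sg -> indivisible A (set_sign sg j 1) ->
  indivisible A (set_sign sg j (-1)) ->
  (forall th1 th2, 0 <= (lam - band V i0 th1) * (lam - band V i0 th2)) ->
  (forall th, Z th -> band V i0 th = lam) ->
  0 < sigma -> d%:R - 2 < sigma -> hnull sigma Z.
Proof.
move=> d2 hsg ind1 ind2 hext hZ sig0 sigd.
have N0 : (0 < N)%N by exact: leq_ltn_trans (leq0n i0) (ltn_ord i0).
pose D : 'M[C]_N := potential_mx A V - (real_complex R lam)%:M.
pose p th := char_poly (transfer j D (torus th)).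
have p0 th : p th != 0 by exact/monic_neq0/char_poly_monic.
have [s1 hs1'] := laurent_det (laurent_bulk D).
have hs1 th : \det (floquet_mx A V th - (real_complex R lam)%:M) = trig s1 th.
  rewrite det_floquet // trigE -hs1' => [|k]; last exact: torus_neq0.
  by rewrite /D addrA.
have [s2 [s2j hs2]] := discriminant_trig j D N0.
have [z z0 zsep] := transfer_separable rkA D hsg ind1 ind2 d2.
have nz : leval s2 z != 0.
  rewrite -hs2 // /discriminant resultant_eq0 -leqNgt.
  by move: zsep; rewrite separable_poly.unlock /coprimep => /eqP ->.
have [v0 v0k hv0] := trig_generic nz z0.
pose v : 'rV[R]_d := v0 - v0 0 j *: delta_mx 0 j.
have vj : v 0 j = 0 by rewrite !mxE !eqxx mulr1 subrr.
have [k kj] : exists k, k != j.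
  have [->|h] := eqVneq j (Ordinal (ltnW d2)); first by exists (Ordinal d2).
  by exists (Ordinal (ltnW d2)); rewrite eq_sym.
have vk : v 0 k != 0 by rewrite !mxE (negPf kj) andbF mulr0 subr0.
have vs2 m th : trig (iter m (dtrig v) s2) th = trig (iter m (dtrig v0) s2) th.
  rewrite !trig_iter; apply: eq_big_seq => t /s2j t0.
  suff -> : dfreq v t.2 = dfreq v0 t.2 by [].
  congr tau_i; rewrite /dotv; apply: eq_bigr => l _; rewrite !mxE.
  case: (eqVneq l j) => [->|lj]; first by rewrite t0 !mulr0.
  by rewrite andbF mulr0 subr0.
have torusD th t : torus (th + t *: delta_mx 0 j) =
    fun l => if l == j then torus th j * cis2pi t else torus th l.
  apply/funext => l; rewrite /torus !mxE eqxx /=; case: eqVneq => [->|_].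
    by rewrite mulr1 cis2piD.
  by rewrite mulr0 addr0.
have pD th t : (p th).[torus th j * cis2pi t] =
    (torus th j * cis2pi t) ^+ N * \det (shift_mx R A (- delta_mx 0 j)) *
      trig s1 (th + t *: delta_mx 0 j).
  rewrite -hs1 det_floquet // -addrA -/D /p.
  have <- : transfer j D (torus (th + t *: delta_mx 0 j)) = transfer j D (torus th).
    by apply: transfer_indep => l lj; rewrite torusD (negPf lj).
  have e : torus th j * cis2pi t = torus (th + t *: delta_mx 0 j) j by rewrite torusD eqxx.
  by rewrite e transfer_root // torus_neq0.
apply: (zeros_hnull (s1 := s1) kj vj vk sig0 sigd s2j) => th /hZ hth.
- have [K [t0 [t00 hK]]] := det_floquet_quadratic rkA (delta_mx 0 j) hext hth hs1.
  have x1 : normc (torus th j) = 1 by exact: normc_cis2pi.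
  have [|pr p'r] := @double_root _ (p th) (torus th j)
     (normc (\det (shift_mx R A (- delta_mx 0 j))) * K) t0 x1 t00.
    move=> t tt0; rewrite pD !normcM.
    have -> : normc ((torus th j * cis2pi t) ^+ N) = 1.
      by elim: (N) => [|n IH]; rewrite ?normc1 // exprS !normcM IH x1 normc_cis2pi !mulr1.
    by rewrite mul1r -mulrA ler_wpM2l ?normc_ge0 // hK.
  split; last first.
    rewrite trigE -hs2 => [|l]; last exact: torus_neq0.
    exact: resultant_double_root (p0 th) pr p'r.
  rewrite -hs1 det_floquet_bands // (bigD1 i0) //= hth subrr mul0r mulr0 //.
- have [t ht] := exists_nonroot (p0 th) (torus_neq0 th j).
  apply: (@trig_line_nonzero _ _ _ _ _ t).
  by apply: contraNneq ht => h; rewrite rootE pD h mulr0.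
- by have [m hm] := hv0 th; exists m; rewrite vs2.
Qed.

End LevelSets.

Theorem theorem1p1 (R : realType) (d : nat) (A : 'M[int]_d)
    (V : 'rV[int]_d -> R) :
  (2 <= d)%N ->
  full_rank R A ->
  ~ divisible R (lattice A) ->
  periodic_potential (lattice A) V ->
  forall j : 'I_(nbands R A),
    (hausdorff_dim [set theta : 'rV[R]_d | dual_cell A theta /\
                                          band V j theta = band_min V j]
       <= (d%:R - 2)%:E)%E /\
    (hausdorff_dim [set theta : 'rV[R]_d | dual_cell A theta /\
                                          band V j theta = band_max V j]
       <= (d%:R - 2)%:E)%E.
Proof.
move=> d2 rkA ndiv _ i0.
have [j [sg [hsg ind1 ind2]]] := not_divisible_signs ndiv.
have d2' : 0 <= d%:R - 2 :> R by rewrite subr_ge0 ler_nat.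
split; apply: hausdorff_dim_le => // s s0 sd.
- apply: (level_set_hnull rkA (i0 := i0) (lam := band_min V i0) d2 hsg ind1 ind2 _ _ s0 sd).
    by move=> th1 th2; apply: mulr_le0; rewrite subr_le0; exact: band_min_le.
  by move=> th [].
- apply: (level_set_hnull rkA (i0 := i0) (lam := band_max V i0) d2 hsg ind1 ind2 _ _ s0 sd).
    by move=> th1 th2; apply: mulr_ge0; rewrite subr_ge0; exact: band_max_ge.
  by move=> th [].
Qed.
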